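(* Let $M>0$. For every $H\in\mathbb{R}$ and every pair of symmetric boundary data $(T_0,X_0)$, $(T_0,-X_0)$ in the Kruskal extension, with $X_0>0$, there exists one and only one spacelike, spherically symmetric, constant mean curvature (SS-CMC) hypersurface $\Sigma:(T=F(X),X,\theta,\phi)$, $X\in[-X_0,X_0]$, in the Kruskal extension solving the Dirichlet problem: $F$ satisfies $$F''(X)+e^{-\frac{r}{2M}}\left(\frac{6M}{r^2}-\frac1r\right)\bigl(-F(X)+F'(X)X\bigr)\bigl(1-(F'(X))^2\bigr)+\frac{12HM\,e^{-\frac{r}{4M}}}{\sqrt{r}}\bigl(1-(F'(X))^2\bigr)^{\frac32}=0,$$ where $r=r(F(X),X)$, together with the spacelike condition $1-(F'(X))^2>0$ and the boundary condition $F(X_0)=F(-X_0)=T_0$.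
   Context: The Kruskal extension of the Schwarzschild spacetime of mass $M>0$ is described by coordinates $(T,X,\theta,\phi)$, where $(\theta,\phi)$ are spherical coordinates on $\mathbb{S}^2$ and $(T,X)\in\mathbb{R}^2$ ranges over the set $X^2-T^2>-2M$. The function $r=r(T,X)>0$ is defined implicitly by $(r-2M)e^{r/(2M)}=X^2-T^2$. The metric is $$ds^2=\frac{16M^2e^{-r/(2M)}}{r}\,(-dT^2+dX^2)+r^2\,d\theta^2+r^2\sin^2\theta\,d\phi^2.$$ A spherically symmetric hypersurface is written as a graph $T=F(X)$ with $F$ independent of $\theta,\phi$. It lies in the Kruskal extension when $X^2-F(X)^2>-2M$ for all $X$ in its domain. The displayed second-order equation is the SS-CMC equation with constant mean curvature parameter $H$. The angular coordinates are omitted when writing points $(T,X)$. *)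

(* Defs.v *)
From Stdlib Require Import Reals Lra ClassicalEpsilon.
Open Scope R_scope.

Definition in_kruskal (M T X : R) : Prop := X ^ 2 - T ^ 2 > - 2 * M.

Definition is_radius (M T X r : R) : Prop :=
  0 < r /\ (r - 2 * M) * exp (r / (2 * M)) = X ^ 2 - T ^ 2.

(* On the Kruskal extension the value is characterized by [radius_spec] and
   [radius_unique]; outside it is irrelevant. *)
Definition radius (M T X : R) : R := epsilon (inhabits 0) (is_radius M T X).

Lemma radius_spec (M T X : R) :
  0 < M -> in_kruskal M T X -> is_radius M T X (radius M T X).
Proof.
intros HM HK; unfold radius; apply epsilon_spec.
unfold in_kruskal in HK; unfold is_radius.
set (s := X ^ 2 - T ^ 2) in *.
set (g := fun r => (r - 2 * M) * exp (r / (2 * M)) - s).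
assert (Hc : continuity g) by (unfold g; reg; lra).
assert (Hs := Rle_abs s); assert (Hs0 := Rabs_pos s).
set (b := 2 * M + Rabs s + 1).
assert (Hb : 0 < b) by (unfold b; lra).
assert (H0 : g 0 < 0).
{ unfold g; replace (0 / (2 * M)) with 0 by (field; lra).
  rewrite exp_0; lra. }
assert (H1 : 0 < g b).
{ unfold g.
  assert (He : 0 < b / (2 * M)) by (apply Rdiv_lt_0_compat; lra).
  assert (He1 := exp_ineq1_le (b / (2 * M))).
  replace (b - 2 * M) with (Rabs s + 1) by (unfold b; ring).
  nra. }
destruct (IVT g 0 b Hc Hb H0 H1) as [z [[Hz0 _] Hz]].
exists z; split.
- destruct Hz0 as [Hz0 | Hz0]; [exact Hz0 | subst z; lra].
- unfold g in Hz; lra.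
Qed.

Lemma is_radius_lt (M x y : R) : 0 < M -> 0 < x -> x < y ->
  (x - 2 * M) * exp (x / (2 * M)) < (y - 2 * M) * exp (y / (2 * M)).
Proof.
intros HM Hx Hxy.
set (a := x / (2 * M)); set (b := y / (2 * M)).
replace x with (2 * M * a) by (unfold a; field; lra).
replace y with (2 * M * b) by (unfold b; field; lra).
assert (Ha : 0 < a) by (apply Rdiv_lt_0_compat; lra).
assert (Hab : a < b)
  by (apply Rmult_lt_compat_r; [apply Rinv_0_lt_compat; lra | lra]).
assert (Ea := exp_pos a); assert (Eb := exp_pos b).
assert (Hlt := exp_increasing a b Hab).
assert (Hkey : (a - 1) * exp a < (b - 1) * exp b).
{ destruct (Rle_lt_dec 1 a) as [H1 | H1]; [nra |].
  assert (He : exp b * (1 + (a - b)) <= exp a).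
  { replace (exp a) with (exp b * exp (a - b))
      by (rewrite <- exp_plus; f_equal; ring).
    apply Rmult_le_compat_l; [lra | apply exp_ineq1_le]. }
  assert ((a - 1) * exp a <= (a - 1) * (exp b * (1 + (a - b)))) by nra.
  assert (0 < exp b * (a * (b - a)))
    by (apply Rmult_lt_0_compat; [lra | apply Rmult_lt_0_compat; lra]).
  nra. }
replace (2 * M * a - 2 * M) with (2 * M * (a - 1)) by ring.
replace (2 * M * b - 2 * M) with (2 * M * (b - 1)) by ring.
rewrite !Rmult_assoc.
apply Rmult_lt_compat_l; [lra |].
apply Rmult_lt_compat_l; [lra |].
exact Hkey.
Qed.

Lemma radius_unique (M T X r : R) :
  0 < M -> is_radius M T X r -> r = radius M T X.
Proof.
intros HM Hr.
assert (Hr' : is_radius M T X (radius M T X))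
  by (unfold radius; apply epsilon_spec; exists r; exact Hr).
destruct Hr as [Hp He]; destruct Hr' as [Hp' He'].
destruct (Rtotal_order r (radius M T X)) as [Hl | [Hl | Hl]].
- pose proof (is_radius_lt M _ _ HM Hp Hl); lra.
- exact Hl.
- pose proof (is_radius_lt M _ _ HM Hp' Hl); lra.
Qed.

(* [F], [F1], [F2] stand for the values of F, F', F'' at X. *)
Definition SS_CMC_equation (M H X F F1 F2 : R) : Prop :=
  let r := radius M F X in
  F2
  + exp (- (r / (2 * M))) * (6 * M / r ^ 2 - 1 / r)
    * (- F + F1 * X) * (1 - F1 ^ 2)
  + 12 * H * M * exp (- (r / (4 * M))) / sqrt r
    * Rpower (1 - F1 ^ 2) (3 / 2) = 0.

Definition sym_interval (X0 X : R) : Prop := - X0 <= X <= X0.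

(* [D_in] is the derivative relative to the closed interval, hence one-sided
   at the endpoints. The values of [F] outside the interval play no role. *)
Definition SS_CMC_Dirichlet_solution (M H T0 X0 : R) (F : R -> R) : Prop :=
  exists F1 F2 : R -> R,
    (forall X, sym_interval X0 X ->
       D_in F F1 (sym_interval X0) X /\
       D_in F1 F2 (sym_interval X0) X /\
       in_kruskal M (F X) X /\
       1 - F1 X ^ 2 > 0 /\
       SS_CMC_equation M H X (F X) (F1 X) (F2 X)) /\
    F X0 = T0 /\ F (- X0) = T0.

(* Main.v *)
Require Import Defs.
From Stdlib Require Import Reals Lra Lia Psatz ClassicalEpsilon.
From Coquelicot Require Import Coquelicot.
Open Scope R_scope.

(** Write [F' = tanh u] with [u] the rapidity. With [s = X^2 - F^2] and [r] the
    radius, the equation becomes [u' = A(r) (F - X tanh u) - B(r) / cosh u],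
    whose right side is bounded wherever [r] stays away from [0]. The solution is
    found by shooting from the left endpoint [(T0, -X0)] with initial rapidity [b].

    The singularity [r = 0] cannot be reached by a solution of the boundary value
    problem ([barrier]): near it [F u' > 1], so
    [s'' = 2 (1 - F u') / cosh^2 u < 0], and [s] has no interior minimum there.
    The level below which this happens depends only on the data. The equation may
    therefore be truncated near [r = 0], which makes the field bounded and globally
    Lipschitz, without changing the set of solutions having the prescribed boundary
    values. For the truncated equation the end value [F_b(X0)] is a continuous
    function of [b] that lies above [T0] for large [b] and below it for very negative
    [b]; this gives existence ([shooting_hits]).

    Uniqueness says that [b] is determined by [F_b(X0) = T0]. It suffices that
    [b |-> F_b(X0)] crosses the value [T0] only upwards ([unique_crossing],
    [endpoint_increasing]). The first variation of a solution is governed by the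
    Jacobi operator of a spacelike hypersurface of constant mean curvature in a
    vacuum spacetime: the lapse [N] of the variation satisfies
    [(r^2 N_l)_l = r^2 |A|^2 N] in the arclength [l], with [A] the second fundamental
    form. The potential has the good sign, so a lapse that vanishes at the left end
    and starts to grow keeps growing and is positive at the right end. In
    coordinates this is the linear system of [jacobi_system], with the potential
    computed in [jacobi_potential]. The statement on the nonlinear family follows
    because neighbouring solutions differ from the linearized ones by a quadratic
    error, uniformly on the interval ([accel_variation]), and the linear system
    resists perturbations of that size ([cooperative_positive]). *)

(** * One-variable calculus *)

Lemma mean_value (f f' : R -> R) (a b : R) : a <= b ->
  (forall x, a <= x <= b -> is_derive f x (f' x)) ->
  exists c, a <= c <= b /\ f b - f a = f' c * (b - a).
Proof.
intros Hab Hd.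
destruct (MVT_gen f a b f') as [c [Hc He]].
- intros x Hx; rewrite Rmin_left, Rmax_right in Hx by lra; apply Hd; lra.
- intros x Hx; rewrite Rmin_left, Rmax_right in Hx by lra.
  apply derivable_continuous_pt; exists (f' x); apply is_derive_Reals, Hd; lra.
- rewrite Rmin_left, Rmax_right in Hc by lra; exists c; auto.
Qed.

Lemma increasing_of_derive (f f' : R -> R) (a b : R) : a <= b ->
  (forall x, a <= x <= b -> is_derive f x (f' x)) ->
  (forall x, a <= x <= b -> 0 <= f' x) -> f a <= f b.
Proof.
intros Hab Hd Hp; destruct (mean_value f f' a b Hab Hd) as [c [Hc He]].
specialize (Hp c Hc); nra.
Qed.

Lemma dominated_by_derive (u u' v v' : R -> R) (a b : R) :
  (forall x, a <= x <= b -> is_derive u x (u' x)) ->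
  (forall x, a <= x <= b -> is_derive v x (v' x)) ->
  (forall x, a <= x <= b -> Rabs (u' x) <= v' x) -> Rabs (u a) <= v a ->
  forall x, a <= x <= b -> Rabs (u x) <= v x.
Proof.
intros Hu Hv Hle H0 x Hx.
assert (H1 : v a - u a <= v x - u x).
{ apply (increasing_of_derive (fun t => v t - u t) (fun t => v' t - u' t)); [lra| |].
  - intros t Ht; apply (is_derive_minus v u); [apply Hv | apply Hu]; lra.
  - intros t Ht; specialize (Hle t ltac:(lra)).
    assert (H := Rle_abs (u' t)); lra. }
assert (H2 : v a + u a <= v x + u x).
{ apply (increasing_of_derive (fun t => v t + u t) (fun t => v' t + u' t)); [lra| |].
  - intros t Ht; apply (is_derive_plus v u); [apply Hv | apply Hu]; lra.
  - intros t Ht; specialize (Hle t ltac:(lra)).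
    assert (H := Rle_abs (- u' t)); rewrite Rabs_Ropp in H; lra. }
assert (H3 := Rle_abs (u a)); assert (H4 := Rle_abs (- u a)); rewrite Rabs_Ropp in H4.
apply Rabs_le; lra.
Qed.

Lemma is_derive_continuity (f : R -> R) (x l : R) :
  is_derive f x l -> continuity_pt f x.
Proof.
intros Hd; apply derivable_continuous_pt; exists l; now apply is_derive_Reals.
Qed.

Lemma is_derive_val (f : R -> R) (x l l' : R) : l = l' -> is_derive f x l -> is_derive f x l'.
Proof. now intros ->. Qed.

Lemma is_derive_comp_R (f g : R -> R) (x df dg : R) :
  is_derive f (g x) df -> is_derive g x dg -> is_derive (fun t => f (g t)) x (df * dg).
Proof.
intros Hf Hg; apply (is_derive_val _ _ (dg * df)); [ring|].
now apply (is_derive_comp f g).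
Qed.

Ltac use_derive H :=
  match type of H with
  | is_derive ?f ?x ?l =>
      replace (Derive (fun t => f t) x) with l by (symmetry; exact (is_derive_unique f x l H))
  end.

(** [c] is the supremum of the [t] such that [f] stays above [k] on [a <= x <= t]. *)
Lemma first_hitting (f : R -> R) (a b k : R) : a <= b ->
  (forall x, a <= x <= b -> continuity_pt f x) -> k < f a -> f b <= k ->
  exists c, a < c <= b /\ f c = k /\ forall x, a <= x < c -> k < f x.
Proof.
intros Hab Hc Ha Hb.
set (E := fun t => a <= t <= b /\ forall x, a <= x <= t -> k < f x).
destruct (completeness E) as [m [Hub Hlub]].
{ exists b; intros t [Ht _]; lra. }
{ exists a; split; [lra|]; intros x Hx; replace x with a by lra; exact Ha. }
assert (Ham : a <= m).
{ apply Hub; split; [lra|]; intros x Hx; replace x with a by lra; exact Ha. }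
assert (Hmb : m <= b) by (apply Hlub; intros t [Ht _]; lra).
assert (Hbelow : forall x, a <= x < m -> k < f x).
{ intros x Hx; destruct (Rlt_le_dec k (f x)) as [H | H]; [exact H|].
  exfalso; assert (Hle : m <= x); [|lra].
  apply Hlub; intros t [Ht Hf]; destruct (Rle_lt_dec t x) as [H' | H']; [exact H'|].
  assert (k < f x) by (apply Hf; lra); lra. }
assert (Hloc : forall eps, 0 < eps -> exists d, 0 < d /\
          forall x, Rabs (x - m) < d -> Rabs (f x - f m) < eps).
{ intros eps He; destruct (Hc m (conj Ham Hmb) eps He) as [d [Hd H]].
  exists d; split; [exact Hd|]; intros x Hx.
  destruct (Req_dec x m) as [-> | Hne].
  - rewrite Rminus_diag, Rabs_R0; exact He.
  - apply H; split; [split; [exact I | lra] | exact Hx]. }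
exists m; destruct (Rtotal_order (f m) k) as [H | [H | H]].
- exfalso; destruct (Hloc (k - f m)) as [d [Hd Hl]]; [lra|].
  destruct (Req_dec a m) as [He | Hne]; [subst m; lra|].
  set (x := Rmax a (m - d / 2)).
  assert (a <= x) by apply Rmax_l; assert (m - d / 2 <= x) by apply Rmax_r.
  assert (x < m) by (apply Rmax_lub_lt; lra).
  assert (Hx := Hl x); rewrite (Rabs_left (x - m)) in Hx by lra.
  assert (Rabs (f x - f m) < k - f m) by (apply Hx; lra).
  assert (k < f x) by (apply Hbelow; lra).
  rewrite Rabs_right in H3 by lra; lra.
- repeat split; try assumption; try lra.
  destruct (Req_dec a m) as [He | Hne]; [subst m; lra | lra].
- exfalso; destruct (Hloc (f m - k)) as [d [Hd Hl]]; [lra|].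
  assert (Hmb' : m < b) by (destruct (Req_dec m b); [subst m; lra | lra]).
  set (t := Rmin b (m + d / 2)).
  assert (t <= b) by apply Rmin_l; assert (t <= m + d / 2) by apply Rmin_r.
  assert (m < t) by (apply Rmin_glb_lt; lra).
  assert (t <= m); [|lra].
  apply Hub; split; [lra|]; intros x Hx.
  destruct (Rlt_le_dec x m) as [H' | H']; [apply Hbelow; lra|].
  assert (Hx' := Hl x); rewrite (Rabs_right (x - m)) in Hx' by lra.
  assert (Hx2 : Rabs (f x - f m) < f m - k) by (apply Hx'; lra).
  apply Rabs_def2 in Hx2; lra.
Qed.

(** After an upward crossing at [a] the first return to the level [k] would be
    a downward crossing. *)
Lemma unique_crossing (g : R -> R) (k : R) : continuity g ->
  (forall a, g a = k -> exists d, 0 < d /\ forall b, 0 < Rabs (b - a) < d ->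
     0 < (g b - g a) * (b - a)) ->
  forall a b, a < b -> g a = k -> g b = k -> False.
Proof.
intros Hc Hup a b Hab Ha Hb.
destruct (Hup a Ha) as [d [Hd Hda]].
set (a' := a + Rmin (d / 2) ((b - a) / 2)).
assert (H1 := Rmin_l (d / 2) ((b - a) / 2)); assert (H2 := Rmin_r (d / 2) ((b - a) / 2)).
assert (H3 : 0 < Rmin (d / 2) ((b - a) / 2)) by (apply Rmin_glb_lt; lra).
assert (Hga' : k < g a').
{ assert (Hpos : 0 < (g a' - g a) * (a' - a)).
  { apply Hda; unfold a'; rewrite Rabs_right; lra. }
  unfold a' in *; nra. }
destruct (first_hitting g a' b k) as [c [Hc1 [Hgc Hbefore]]];
  [unfold a'; lra | intros; apply Hc | exact Hga' | lra|].
destruct (Hup c Hgc) as [e [He Hce]].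
set (c' := c - Rmin (e / 2) ((c - a') / 2)).
assert (K1 := Rmin_l (e / 2) ((c - a') / 2)); assert (K2 := Rmin_r (e / 2) ((c - a') / 2)).
assert (K3 : 0 < Rmin (e / 2) ((c - a') / 2)) by (apply Rmin_glb_lt; lra).
assert (Hgc' : k < g c') by (apply Hbefore; unfold c'; lra).
assert (Hpos : 0 < (g c' - g c) * (c' - c)).
{ apply Hce; unfold c'; rewrite Rabs_left; lra. }
unfold c' in *; nra.
Qed.

Lemma derive_neg_right (f : R -> R) (x l b : R) :
  is_derive f x l -> l < 0 -> x < b ->
  exists y, x < y <= b /\ forall z, x < z <= y -> f z < f x.
Proof.
intros Hd Hl Hxb; apply is_derive_Reals in Hd.
destruct (Hd (- l)) as [d H]; [lra|].
exists (Rmin b (x + d / 2)).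
assert (Hd0 := cond_pos d).
assert (H1 := Rmin_l b (x + d / 2)); assert (H2 := Rmin_r b (x + d / 2)).
assert (H3 : x < Rmin b (x + d / 2)) by (apply Rmin_glb_lt; lra).
split; [lra|]; intros z Hz.
assert (Hq : Rabs ((f (x + (z - x)) - f x) / (z - x) - l) < - l).
{ apply H; [lra|]; rewrite Rabs_right; lra. }
replace (x + (z - x)) with z in Hq by ring.
apply Rabs_def2 in Hq.
assert (Hn : (f z - f x) / (z - x) < 0) by lra.
assert (f z - f x = (f z - f x) / (z - x) * (z - x)) by (field; lra).
nra.
Qed.

Lemma minimum_second_derivative (f f' : R -> R) (a b m l : R) :
  a < m < b ->
  (forall x, a <= x <= b -> is_derive f x (f' x)) ->
  is_derive f' m l -> l < 0 -> (forall x, a <= x <= b -> f m <= f x) -> False.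
Proof.
intros Hm Hf Hf' Hl Hmin.
assert (H0 : f' m = 0).
{ destruct (Rtotal_order (f' m) 0) as [H | [H | H]]; [|exact H|]; exfalso.
  - destruct (derive_neg_right f m (f' m) b) as [y [Hy Hz]]; [apply Hf; lra | lra | lra|].
    assert (f y < f m) by (apply Hz; lra); assert (f m <= f y) by (apply Hmin; lra); lra.
  - destruct (derive_neg_right (fun x => f (- x)) (- m) (- f' m) (- a)) as [y [Hy Hz]]; [| lra | lra|].
    + replace (- f' m) with (scal (-1) (f' m)) by (unfold scal; simpl; unfold mult; simpl; ring).
      apply (is_derive_comp f (fun x => - x)).
      * rewrite Ropp_involutive; apply Hf; lra.
      * auto_derive; [trivial | ring].
    + assert (f (- y) < f (- - m)) by (apply Hz; lra); rewrite Ropp_involutive in H0.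
      assert (f m <= f (- y)) by (apply Hmin; lra); lra. }
destruct (derive_neg_right f' m l b Hf' Hl) as [y [Hy Hz]]; [lra|].
destruct (mean_value f f' m y) as [c [Hc He]]; [lra | intros; apply Hf; lra|].
assert (Hmy : f m <= f y) by (apply Hmin; lra).
assert (Hcm : f' c <= 0).
{ destruct (Req_dec c m) as [-> | Hne]; [lra|].
  assert (f' c < f' m) by (apply Hz; lra); lra. }
assert (Hstrict : f y < f m); [|lra].
destruct (mean_value f f' ((m + y) / 2) y) as [c' [Hc' He']]; [lra | intros; apply Hf; lra|].
assert (f' c' < f' m) by (apply Hz; lra).
destruct (mean_value f f' m ((m + y) / 2)) as [d [Hdd He2]]; [lra | intros; apply Hf; lra|].
assert (f' d <= 0).
{ destruct (Req_dec d m) as [-> | Hne]; [lra|].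
  assert (f' d < f' m) by (apply Hz; lra); lra. }
nra.
Qed.

(** * Uniform first-order expansions *)

(** Uniform bounds for a composition with [f], of derivative [f']: the Lipschitz
    bound serves for vector fields, the quadratic remainder for first variations.
    The domain is a predicate so that [tanh] can be used on the whole line. *)
Definition C2on (f f' : R -> R) (D : R -> Prop) : Prop :=
  exists C, forall x y, D x -> D y ->
    Rabs (f x) <= C /\ Rabs (f' x) <= C /\ Rabs (f y - f x) <= C * Rabs (y - x) /\
    Rabs (f y - f x - f' x * (y - x)) <= C * (y - x) ^ 2.

Lemma mean_value_abs (f f' : R -> R) (x y C : R) :
  (forall z, Rmin x y <= z <= Rmax x y -> is_derive f z (f' z)) ->
  (forall z, Rmin x y <= z <= Rmax x y -> Rabs (f' z) <= C) ->
  Rabs (f y - f x) <= C * Rabs (y - x).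
Proof.
intros Hd HC.
destruct (MVT_gen f x y f') as [c [Hc He]].
- intros z Hz; apply Hd; lra.
- intros z Hz; apply (is_derive_continuity f z (f' z)), Hd, Hz.
- rewrite He, Rabs_mult; apply Rmult_le_compat_r; [apply Rabs_pos | now apply HC].
Qed.

Lemma C2on_bounded (f f' f'' : R -> R) (D : R -> Prop) (C : R) :
  (forall x y z, D x -> D y -> x <= z <= y -> D z) ->
  (forall x, D x -> is_derive f x (f' x)) ->
  (forall x, D x -> is_derive f' x (f'' x)) ->
  (forall x, D x -> Rabs (f x) <= C /\ Rabs (f' x) <= C /\ Rabs (f'' x) <= C) ->
  C2on f f' D.
Proof.
intros HD Hf Hf' HC; exists C; intros x y Hx Hy.
assert (Hseg : forall z, Rmin x y <= z <= Rmax x y -> D z).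
{ intros z Hz; destruct (Rle_lt_dec x y).
  - rewrite Rmin_left, Rmax_right in Hz by lra; now apply (HD x y).
  - rewrite Rmin_right, Rmax_left in Hz by lra; now apply (HD y x). }
split; [now apply HC|]; split; [now apply HC|]; split.
- apply (mean_value_abs f f'); intros z Hz; [apply Hf, Hseg, Hz | apply HC, Hseg, Hz].
- replace (f y - f x - f' x * (y - x))
    with ((f y - f' x * y) - (f x - f' x * x)) by ring.
  replace (C * (y - x) ^ 2) with (C * Rabs (y - x) * Rabs (y - x)).
  2:{ rewrite <- (Rabs_pos_eq ((y - x) ^ 2)) by apply pow2_ge_0.
      simpl; rewrite Rmult_1_r, Rabs_mult; ring. }
  apply (mean_value_abs (fun z => f z - f' x * z) (fun z => f' z - f' x)).
  + intros z Hz; apply (is_derive_minus f (fun z => f' x * z)); [apply Hf, Hseg, Hz|].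
    auto_derive; [trivial | ring].
  + intros z Hz.
    apply Rle_trans with (C * Rabs (z - x)).
    * apply (mean_value_abs f' f'').
      -- intros w Hw; apply Hf', Hseg; revert Hz Hw; unfold Rmin, Rmax.
         repeat destruct (Rle_dec _ _); lra.
      -- intros w Hw; apply HC, Hseg; revert Hz Hw; unfold Rmin, Rmax.
         repeat destruct (Rle_dec _ _); lra.
    * apply Rmult_le_compat_l.
      -- apply Rle_trans with (Rabs (f x)); [apply Rabs_pos | now apply HC].
      -- revert Hz; unfold Rmin, Rmax, Rabs.
         repeat destruct (Rle_dec _ _); repeat destruct (Rcase_abs _); lra.
Qed.

Lemma bounded_on_interval (f : R -> R) (a b : R) :
  (forall x, a <= x <= b -> continuity_pt f x) ->
  exists C, forall x, a <= x <= b -> Rabs (f x) <= C.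
Proof.
intros Hc; destruct (Rle_lt_dec a b) as [Hab | Hab]; [|exists 0; intros; lra].
destruct (continuity_ab_maj (fun x => Rabs (f x)) a b Hab) as [m [Hm _]].
- intros x Hx; apply (continuity_pt_comp f Rabs); [|apply Rcontinuity_abs].
  apply Hc, Hx.
- exists (Rabs (f m)); exact Hm.
Qed.

Lemma bounded_on_interval_pos (f : R -> R) (a b : R) :
  (forall x, a <= x <= b -> ex_derive f x) ->
  exists C, 0 < C /\ forall x, a <= x <= b -> Rabs (f x) <= C.
Proof.
intros Hf; destruct (bounded_on_interval f a b) as [C HC].
- intros x Hx; destruct (Hf x Hx) as [l Hl]; exact (is_derive_continuity _ _ _ Hl).
- exists (Rabs C + 1); split; [assert (H := Rabs_pos C); lra|].
  intros x Hx; specialize (HC x Hx); assert (H := Rle_abs C); lra.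
Qed.

Lemma C2on_interval (f f' f'' : R -> R) (a b : R) :
  (forall x, a <= x <= b -> is_derive f x (f' x)) ->
  (forall x, a <= x <= b -> is_derive f' x (f'' x)) ->
  (forall x, a <= x <= b -> continuity_pt f'' x) ->
  C2on f f' (fun x => a <= x <= b).
Proof.
intros Hf Hf' Hf''.
destruct (bounded_on_interval f a b) as [C0 H0].
{ intros x Hx; apply (is_derive_continuity f x (f' x)), Hf, Hx. }
destruct (bounded_on_interval f' a b) as [C1 H1].
{ intros x Hx; apply (is_derive_continuity f' x (f'' x)), Hf', Hx. }
destruct (bounded_on_interval f'' a b Hf'') as [C2 H2].
apply (C2on_bounded f f' f'' _ (Rmax C0 (Rmax C1 C2))); try assumption.
- intros x y z; lra.
- intros x Hx; specialize (H0 x Hx); specialize (H1 x Hx); specialize (H2 x Hx).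
  assert (A := Rmax_l C0 (Rmax C1 C2)); assert (B := Rmax_r C0 (Rmax C1 C2)).
  assert (A' := Rmax_l C1 C2); assert (B' := Rmax_r C1 C2); lra.
Qed.

(** * Bounded Lipschitz functions of three variables *)

Definition BL (f : R -> R -> R -> R) : Prop :=
  exists C, 0 <= C /\ (forall x y z, Rabs (f x y z) <= C) /\
    forall x y z x' y' z', Rabs (f x' y' z' - f x y z)
      <= C * (Rabs (x' - x) + Rabs (y' - y) + Rabs (z' - z)).

Lemma BL_ext (f g : R -> R -> R -> R) : (forall x y z, f x y z = g x y z) -> BL f -> BL g.
Proof.
intros E [C [HC [Hb Hl]]]; exists C; split; [exact HC|]; split.
- intros; rewrite <- E; apply Hb.
- intros; rewrite <- !E; apply Hl.
Qed.

Lemma BL_const (c : R) : BL (fun _ _ _ => c).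
Proof.
exists (Rabs c); split; [apply Rabs_pos|]; split; [intros; lra|].
intros; rewrite Rminus_diag, Rabs_R0.
apply Rmult_le_pos; [apply Rabs_pos|].
assert (H1 := Rabs_pos (x' - x)); assert (H2 := Rabs_pos (y' - y)).
assert (H3 := Rabs_pos (z' - z)); lra.
Qed.

Lemma BL_plus (f g : R -> R -> R -> R) :
  BL f -> BL g -> BL (fun x y z => f x y z + g x y z).
Proof.
intros [C [HC [Hb Hl]]] [C' [HC' [Hb' Hl']]]; exists (C + C'); split; [lra|]; split.
- intros; apply Rle_trans with (1 := Rabs_triang _ _).
  specialize (Hb x y z); specialize (Hb' x y z); lra.
- intros; replace (f x' y' z' + g x' y' z' - (f x y z + g x y z))
    with ((f x' y' z' - f x y z) + (g x' y' z' - g x y z)) by ring.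
  apply Rle_trans with (1 := Rabs_triang _ _).
  specialize (Hl x y z x' y' z'); specialize (Hl' x y z x' y' z'); lra.
Qed.

Lemma BL_mult (f g : R -> R -> R -> R) :
  BL f -> BL g -> BL (fun x y z => f x y z * g x y z).
Proof.
intros [C [HC [Hb Hl]]] [C' [HC' [Hb' Hl']]]; exists (2 * (C * C')).
assert (0 <= C * C') by nra.
split; [nra|]; split.
- intros; rewrite Rabs_mult; apply Rle_trans with (C * C'); [|nra].
  apply Rmult_le_compat; auto using Rabs_pos.
- intros; replace (f x' y' z' * g x' y' z' - f x y z * g x y z)
    with ((f x' y' z' - f x y z) * g x' y' z' + f x y z * (g x' y' z' - g x y z)) by ring.
  apply Rle_trans with (1 := Rabs_triang _ _); rewrite !Rabs_mult.
  specialize (Hl x y z x' y' z'); specialize (Hl' x y z x' y' z').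
  set (d := Rabs (x' - x) + Rabs (y' - y) + Rabs (z' - z)) in *.
  replace (2 * (C * C') * d) with ((C * d) * C' + C * (C' * d)) by ring.
  apply Rplus_le_compat; apply Rmult_le_compat; auto using Rabs_pos.
Qed.

Lemma BL_comp (h h' : R -> R) (D : R -> Prop) (f : R -> R -> R -> R) :
  C2on h h' D -> (forall x y z, D (f x y z)) ->
  (exists C, 0 <= C /\ forall x y z x' y' z', Rabs (f x' y' z' - f x y z)
      <= C * (Rabs (x' - x) + Rabs (y' - y) + Rabs (z' - z))) ->
  BL (fun x y z => h (f x y z)).
Proof.
intros [C HC] HD [C' [HC' Hl]]; exists (C + C * C').
assert (H0 : 0 <= C).
{ destruct (HC _ _ (HD 0 0 0) (HD 0 0 0)) as [H _].
  apply Rle_trans with (2 := H), Rabs_pos. }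
assert (0 <= C * C') by nra.
split; [lra|]; split.
- intros; destruct (HC _ _ (HD x y z) (HD x y z)) as [H1 _]; lra.
- intros; destruct (HC _ _ (HD x y z) (HD x' y' z')) as [_ [_ [H1 _]]].
  apply Rle_trans with (1 := H1).
  specialize (Hl x y z x' y' z').
  assert (H2 := Rabs_pos (x' - x)); assert (H3 := Rabs_pos (y' - y)).
  assert (H4 := Rabs_pos (z' - z)).
  set (d := Rabs (x' - x) + Rabs (y' - y) + Rabs (z' - z)) in *.
  assert (0 <= d) by (unfold d; lra).
  apply Rle_trans with (C * (C' * d)); [now apply Rmult_le_compat_l|].
  nra.
Qed.

Lemma BL_Lipschitz (f : R -> R -> R -> R) : BL f ->
  exists C, 0 <= C /\ forall x y z x' y' z', Rabs (f x' y' z' - f x y z)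
      <= C * (Rabs (x' - x) + Rabs (y' - y) + Rabs (z' - z)).
Proof. intros [C [HC [_ Hl]]]; exists C; auto. Qed.

Lemma Lipschitz_var (f : R -> R -> R -> R) :
  (forall x y z x' y' z', Rabs (f x' y' z' - f x y z)
      <= Rabs (x' - x) + Rabs (y' - y) + Rabs (z' - z)) ->
  exists C, 0 <= C /\ forall x y z x' y' z', Rabs (f x' y' z' - f x y z)
      <= C * (Rabs (x' - x) + Rabs (y' - y) + Rabs (z' - z)).
Proof. intros Hf; exists 1; split; [lra|]; intros; rewrite Rmult_1_l; apply Hf. Qed.

Lemma Lipschitz_third : exists C, 0 <= C /\ forall x y z x' y' z' : R, Rabs (z' - z)
      <= C * (Rabs (x' - x) + Rabs (y' - y) + Rabs (z' - z)).
Proof.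
apply (Lipschitz_var (fun _ _ z => z)); intros.
assert (H1 := Rabs_pos (x' - x)); assert (H2 := Rabs_pos (y' - y)); lra.
Qed.

Definition clamp (a b x : R) : R := Rmax a (Rmin b x).

Lemma clamp_bounds (a b x : R) : a <= b -> a <= clamp a b x <= b.
Proof.
intros Hab; unfold clamp; split; [apply Rmax_l|].
apply Rmax_lub; [exact Hab | apply Rmin_l].
Qed.

Lemma clamp_id (a b x : R) : a <= x <= b -> clamp a b x = x.
Proof. intros Hx; unfold clamp; rewrite Rmin_right, Rmax_right; lra. Qed.

Lemma clamp_Lipschitz (a b x y : R) : Rabs (clamp a b y - clamp a b x) <= Rabs (y - x).
Proof.
unfold clamp, Rmax, Rmin, Rabs.
repeat destruct (Rle_dec _ _); repeat destruct (Rcase_abs _); lra.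
Qed.

Lemma BL_clamp (a b : R) (f : R -> R -> R -> R) : a <= b ->
  (exists C, 0 <= C /\ forall x y z x' y' z', Rabs (f x' y' z' - f x y z)
      <= C * (Rabs (x' - x) + Rabs (y' - y) + Rabs (z' - z))) ->
  BL (fun x y z => clamp a b (f x y z)).
Proof.
intros Hab [C [HC Hl]]; exists (C + Rabs a + Rabs b).
assert (Ha := Rabs_pos a); assert (Hb := Rabs_pos b).
split; [lra|]; split.
- intros; assert (H := clamp_bounds a b (f x y z) Hab).
  assert (H1 := Rle_abs b); assert (H2 := Rle_abs (- a)); rewrite Rabs_Ropp in H2.
  apply Rabs_le; lra.
- intros; apply Rle_trans with (1 := clamp_Lipschitz _ _ _ _).
  apply Rle_trans with (1 := Hl _ _ _ _ _ _).
  assert (H1 := Rabs_pos (x' - x)); assert (H2 := Rabs_pos (y' - y)).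
  assert (H3 := Rabs_pos (z' - z)); apply Rmult_le_compat_r; lra.
Qed.

(** * Families depending on a parameter *)

(** [f1 = f0 + l + O(d^2)] with [l = O(d)], uniformly in the index, which will
    range over the pairs of a parameter and a point of the interval. *)
Definition variation {I : Type} (d : I -> R) (f0 f1 l : I -> R) : Prop :=
  exists C, 0 <= C /\ forall i, Rabs (f0 i) <= C /\ Rabs (l i) <= C * d i /\
    Rabs (f1 i - f0 i - l i) <= C * d i ^ 2.

Lemma variation_const {I} (d : I -> R) (c : R) : (forall i, 0 <= d i) ->
  variation d (fun _ => c) (fun _ => c) (fun _ => 0).
Proof.
intros Hd; exists (Rabs c); split; [apply Rabs_pos|]; intros i.
assert (H := Rabs_pos c); specialize (Hd i).
replace (c - c - 0) with 0 by ring; rewrite Rabs_R0.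
split; [lra|]; split; [nra|].
apply Rmult_le_pos; [exact H | nra].
Qed.

Lemma variation_increment {I} (d f0 f1 : I -> R) (C : R) : 0 <= C ->
  (forall i, Rabs (f0 i) <= C) -> (forall i, Rabs (f1 i - f0 i) <= C * d i) ->
  variation d f0 f1 (fun i => f1 i - f0 i).
Proof.
intros HC H0 H1; exists C; split; [exact HC|]; intros i; split; [apply H0|]; split; [apply H1|].
rewrite Rminus_diag, Rabs_R0; apply Rmult_le_pos; [exact HC | apply pow2_ge_0].
Qed.

Lemma variation_plus {I} (d : I -> R) (f0 f1 l g0 g1 m : I -> R) :
  variation d f0 f1 l -> variation d g0 g1 m ->
  variation d (fun i => f0 i + g0 i) (fun i => f1 i + g1 i) (fun i => l i + m i).
Proof.
intros [C [HC HfC]] [C' [HC' HgC]]; exists (C + C'); split; [lra|]; intros i.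
destruct (HfC i) as [H1 [H2 H3]]; destruct (HgC i) as [H1' [H2' H3']].
split; [|split].
- apply Rle_trans with (1 := Rabs_triang _ _); lra.
- apply Rle_trans with (1 := Rabs_triang _ _); lra.
- replace (f1 i + g1 i - (f0 i + g0 i) - (l i + m i))
    with ((f1 i - f0 i - l i) + (g1 i - g0 i - m i)) by ring.
  apply Rle_trans with (1 := Rabs_triang _ _); lra.
Qed.

Lemma variation_mult {I} (d : I -> R) (f0 f1 l g0 g1 m : I -> R) :
  (forall i, 0 <= d i <= 1) ->
  variation d f0 f1 l -> variation d g0 g1 m ->
  variation d (fun i => f0 i * g0 i) (fun i => f1 i * g1 i)
    (fun i => l i * g0 i + f0 i * m i).
Proof.
intros Hd [C [HC HfC]] [C' [HC' HgC]]; exists (6 * (C * C')).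
assert (HCC : 0 <= C * C') by nra.
split; [lra|]; intros i; specialize (Hd i).
destruct (HfC i) as [H1 [H2 H3]]; destruct (HgC i) as [H1' [H2' H3']].
assert (Hprod : forall u v a b, Rabs u <= a -> Rabs v <= b -> Rabs (u * v) <= a * b).
{ intros u v a b Hu Hv; rewrite Rabs_mult; apply Rmult_le_compat; auto using Rabs_pos. }
split; [|split].
- apply Rle_trans with (C * C'); [now apply Hprod | lra].
- apply Rle_trans with (1 := Rabs_triang _ _).
  assert (A := Hprod _ _ _ _ H2 H1'); assert (B := Hprod _ _ _ _ H1 H2').
  assert (0 <= C * C' * d i) by nra; lra.
- set (q := f1 i - f0 i - l i) in *; set (q' := g1 i - g0 i - m i) in *.
  replace (f1 i * g1 i - f0 i * g0 i - (l i * g0 i + f0 i * m i))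
    with (f0 i * q' + l i * m i + l i * q' + q * g0 i + q * m i + q * q')
    by (unfold q, q'; ring).
  assert (A1 := Hprod _ _ _ _ H1 H3'); assert (A2 := Hprod _ _ _ _ H2 H2').
  assert (A3 := Hprod _ _ _ _ H2 H3'); assert (A4 := Hprod _ _ _ _ H3 H1').
  assert (A5 := Hprod _ _ _ _ H3 H2'); assert (A6 := Hprod _ _ _ _ H3 H3').
  assert (B1 := Rabs_triang (f0 i * q' + l i * m i + l i * q' + q * g0 i + q * m i) (q * q')).
  assert (B2 := Rabs_triang (f0 i * q' + l i * m i + l i * q' + q * g0 i) (q * m i)).
  assert (B3 := Rabs_triang (f0 i * q' + l i * m i + l i * q') (q * g0 i)).
  assert (B4 := Rabs_triang (f0 i * q' + l i * m i) (l i * q')).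
  assert (B5 := Rabs_triang (f0 i * q') (l i * m i)).
  assert (E2 : d i ^ 2 <= 1) by nra.
  assert (E3 : d i * d i ^ 2 <= d i ^ 2) by nra.
  assert (E4 : d i ^ 2 * d i ^ 2 <= d i ^ 2) by nra.
  assert (F3 := Rmult_le_compat_l _ _ _ HCC E3).
  assert (F4 := Rmult_le_compat_l _ _ _ HCC E4).
  lra.
Qed.

Lemma variation_comp {I} (d : I -> R) (h h' : R -> R) (D : R -> Prop)
    (f0 f1 l : I -> R) :
  (forall i, 0 <= d i <= 1) -> C2on h h' D ->
  (forall i, D (f0 i)) -> (forall i, D (f1 i)) -> variation d f0 f1 l ->
  variation d (fun i => h (f0 i)) (fun i => h (f1 i)) (fun i => h' (f0 i) * l i).
Proof.
intros Hd [C HC] HD0 HD1 [C' [HC' HfC]].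
exists (Rabs C + Rabs C * C' + 4 * Rabs C * C' ^ 2).
assert (HCC := Rabs_pos C); assert (HleC := Rle_abs C).
assert (P1 : 0 <= Rabs C * C') by nra.
assert (P2 : 0 <= 4 * Rabs C * C' ^ 2) by (apply Rmult_le_pos; nra).
split; [lra|]; intros i; specialize (Hd i).
destruct (HC _ _ (HD0 i) (HD1 i)) as [H1 [H2 [_ H3]]].
destruct (HfC i) as [G1 [G2 G3]].
split; [lra|]; split.
- rewrite Rabs_mult.
  apply Rle_trans with (Rabs C * (C' * d i)); [|nra].
  apply Rmult_le_compat; try apply Rabs_pos; lra.
- set (y := f1 i) in *; set (x := f0 i) in *.
  replace (h y - h x - h' x * l i)
    with ((h y - h x - h' x * (y - x)) + h' x * (y - x - l i)) by ring.
  apply Rle_trans with (1 := Rabs_triang _ _); rewrite Rabs_mult.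
  assert (Hyx : Rabs (y - x) <= 2 * C' * d i).
  { replace (y - x) with ((y - x - l i) + l i) by ring.
    apply Rle_trans with (1 := Rabs_triang _ _).
    assert (C' * d i ^ 2 <= C' * d i) by (apply Rmult_le_compat_l; nra); lra. }
  assert (Hsq : (y - x) ^ 2 <= 4 * C' ^ 2 * d i ^ 2).
  { rewrite <- (pow2_abs (y - x)).
    assert (Hp := Rabs_pos (y - x)).
    replace (4 * C' ^ 2 * d i ^ 2) with ((2 * C' * d i) ^ 2) by ring.
    apply pow_incr; lra. }
  assert (K1 : C * (y - x) ^ 2 <= Rabs C * (4 * C' ^ 2 * d i ^ 2)).
  { apply Rle_trans with (Rabs C * (y - x) ^ 2).
    - apply Rmult_le_compat_r; [apply pow2_ge_0 | exact HleC].
    - now apply Rmult_le_compat_l. }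
  assert (K2 : Rabs (h' x) * Rabs (y - x - l i) <= Rabs C * (C' * d i ^ 2)).
  { apply Rmult_le_compat; try apply Rabs_pos; lra. }
  assert (0 <= Rabs C * d i ^ 2) by (apply Rmult_le_pos; [lra | nra]).
  lra.
Qed.

(** * The Cauchy problem for a plane system *)

Definition Lipschitz (C : R) (f : R -> R) : Prop :=
  forall x y, Rabs (f y - f x) <= C * Rabs (y - x).

Lemma Lipschitz_continuity (C : R) (f : R -> R) : Lipschitz C f -> continuity f.
Proof.
intros HL x eps He; exists (eps / (Rabs C + 1)).
assert (HC := Rabs_pos C); assert (HCl := Rle_abs C).
split; [apply Rdiv_lt_0_compat; lra|].
intros y [_ Hy]; unfold dist in *; simpl in *; unfold Rdist in *.
apply Rle_lt_trans with (1 := HL x y).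
apply Rle_lt_trans with ((Rabs C + 1) * Rabs (y - x)).
- apply Rmult_le_compat_r; [apply Rabs_pos | lra].
- replace eps with ((Rabs C + 1) * (eps / (Rabs C + 1))) by (field; lra).
  apply Rmult_lt_compat_l; lra.
Qed.

Lemma is_derive_primitive (f : R -> R) (a c x : R) : continuity f ->
  is_derive (fun t => c + RInt f a t) x (f x).
Proof.
intros Hf.
assert (Hc : forall t, continuous f t) by (intro t; apply continuity_pt_filterlim, Hf).
replace (f x) with (plus 0 (f x)) by (unfold plus; simpl; ring).
apply (is_derive_plus (fun _ => c) (fun t => RInt f a t)).
- apply is_derive_Reals, derivable_pt_lim_const.
- apply (is_derive_RInt f (fun t => RInt f a t) a); [|apply Hc].
  apply filter_forall; intro t; apply (RInt_correct f a t).
  apply (ex_RInt_continuous f); intros; apply Hc.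
Qed.

Lemma primitive_Lipschitz (f : R -> R) (a c C : R) : continuity f ->
  (forall t, Rabs (f t) <= C) -> Lipschitz C (fun x => c + RInt f a x).
Proof.
intros Hf HC x y; apply (mean_value_abs (fun x => c + RInt f a x) f).
- intros; now apply is_derive_primitive.
- intros; apply HC.
Qed.

Lemma pow_half_pos (n : nat) : 0 < (1 / 2) ^ n.
Proof. apply pow_lt; lra. Qed.

Lemma le_of_geometric_error (A B K : R) :
  (forall n, A <= B + K * (1 / 2) ^ n) -> A <= B.
Proof.
intros H; destruct (Rle_lt_dec A B) as [Hle | Hlt]; [exact Hle | exfalso].
assert (HK : 0 < Rabs K + 1) by (assert (H0 := Rabs_pos K); lra).
destruct (pow_lt_1_zero (1 / 2)) with (y := (A - B) / (Rabs K + 1)) as [N HN].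
- rewrite Rabs_right; lra.
- apply Rdiv_lt_0_compat; lra.
- specialize (HN N (le_n N)); specialize (H N).
  assert (Hp := pow_half_pos N); rewrite Rabs_right in HN by lra.
  assert (H1 : (Rabs K + 1) * (1 / 2) ^ N < A - B).
  { replace (A - B) with ((Rabs K + 1) * ((A - B) / (Rabs K + 1))) by (field; lra).
    apply Rmult_lt_compat_l; lra. }
  assert (H2 := Rle_abs K).
  assert (K * (1 / 2) ^ N <= (Rabs K + 1) * (1 / 2) ^ N)
    by (apply Rmult_le_compat_r; lra).
  lra.
Qed.

Lemma geometric_limit (u : nat -> R) (K : R) :
  (forall n, Rabs (u (S n) - u n) <= K * (1 / 2) ^ n) ->
  forall n, Rabs (real (Lim_seq u) - u n) <= 2 * K * (1 / 2) ^ n.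
Proof.
intros Hu.
assert (HK : 0 <= K).
{ specialize (Hu O); simpl in Hu; rewrite Rmult_1_r in Hu.
  apply Rle_trans with (2 := Hu), Rabs_pos. }
assert (Htail : forall n m, Rabs (u (n + m)%nat - u n) <= 2 * K * (1 / 2) ^ n).
{ intros n m.
  cut (Rabs (u (n + m)%nat - u n) <= 2 * K * (1 / 2) ^ n - 2 * K * (1 / 2) ^ (n + m)).
  { assert (H := pow_half_pos (n + m)); nra. }
  induction m as [|m IH].
  - rewrite Nat.add_0_r, Rminus_diag, Rabs_R0; lra.
  - rewrite Nat.add_succ_r.
    replace (u (S (n + m)) - u n) with ((u (S (n + m)) - u (n + m)%nat) + (u (n + m)%nat - u n))
      by ring.
    apply Rle_trans with (1 := Rabs_triang _ _); specialize (Hu (n + m)%nat); simpl; lra. }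
assert (Hlim : is_lim_seq u (Finite (real (Lim_seq u)))).
{ apply Lim_seq_correct', ex_lim_seq_cauchy_corr; intros eps.
  destruct (pow_lt_1_zero (1 / 2)) with (y := eps / (4 * K + 1)) as [N HN].
  - rewrite Rabs_right; lra.
  - apply Rdiv_lt_0_compat; [apply cond_pos | lra].
  - exists N; intros n m Hn Hm.
    assert (H1 := Htail N (n - N)%nat); assert (H2 := Htail N (m - N)%nat).
    replace (N + (n - N))%nat with n in H1 by lia.
    replace (N + (m - N))%nat with m in H2 by lia.
    replace (u n - u m) with ((u n - u N) - (u m - u N)) by ring.
    apply Rle_lt_trans with (1 := Rabs_triang _ _); rewrite Rabs_Ropp.
    specialize (HN N (le_n N)); assert (Hp := pow_half_pos N).
    rewrite Rabs_right in HN by lra.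
    assert ((4 * K + 1) * (1 / 2) ^ N < eps).
    { replace (pos eps) with ((4 * K + 1) * (eps / (4 * K + 1))) by (field; lra).
      apply Rmult_lt_compat_l; lra. }
    lra. }
intros n; apply is_lim_seq_spec in Hlim.
apply le_of_geometric_error with (K := 1); intros k.
destruct (Hlim (mkposreal _ (pow_half_pos k))) as [N HN]; simpl in HN.
specialize (HN (n + N)%nat ltac:(lia)); specialize (Htail n N).
replace (real (Lim_seq u) - u n)
  with ((u (n + N)%nat - u n) - (u (n + N)%nat - real (Lim_seq u))) by ring.
apply Rle_trans with (1 := Rabs_triang _ _); rewrite Rabs_Ropp; lra.
Qed.

Definition solves (a b : R) (f1 f2 : R -> R -> R -> R) (y z : R -> R) : Prop :=
  forall x, a <= x <= b ->
    is_derive y x (f1 x (y x) (z x)) /\ is_derive z x (f2 x (y x) (z x)).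

(** Clamping the argument makes the iterates functions on the line, so that the
    limit has two-sided derivatives at the endpoints [a] and [b]. *)
Fixpoint picard (a b y0 z0 : R) (f1 f2 : R -> R -> R -> R) (n : nat)
  : (R -> R) * (R -> R) :=
  match n with
  | O => (fun _ => y0, fun _ => z0)
  | S k =>
      let p := picard a b y0 z0 f1 f2 k in
      let along f t := f t (fst p (clamp a b t)) (snd p (clamp a b t)) in
      (fun x => y0 + RInt (along f1) a x, fun x => z0 + RInt (along f2) a x)
  end.

Lemma cauchy_lipschitz (a b : R) (f1 f2 : R -> R -> R -> R) (y0 z0 : R) :
  a <= b -> BL f1 -> BL f2 ->
  exists y z, y a = y0 /\ z a = z0 /\ solves a b f1 f2 y z.
Proof.
intros Hab [C1 [HC1 [Hb1 Hl1]]] [C2 [HC2 [Hb2 Hl2]]].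
set (C := C1 + C2).
set (field := fun f => f = f1 \/ f = f2).
assert (HC : 0 <= C) by (unfold C; lra).
assert (Hbound : forall f, field f -> forall x y z, Rabs (f x y z) <= C).
{ intros f [-> | ->] x y z; unfold C; [specialize (Hb1 x y z) | specialize (Hb2 x y z)]; lra. }
assert (Hlip : forall f, field f -> forall x y z x' y' z', Rabs (f x' y' z' - f x y z)
      <= C * (Rabs (x' - x) + Rabs (y' - y) + Rabs (z' - z))).
{ intros f Hf x y z x' y' z'.
  assert (H1 := Rabs_pos (x' - x)); assert (H2 := Rabs_pos (y' - y)).
  assert (H3 := Rabs_pos (z' - z)).
  destruct Hf as [-> | ->];
    [apply Rle_trans with (1 := Hl1 _ _ _ _ _ _) | apply Rle_trans with (1 := Hl2 _ _ _ _ _ _)];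
    apply Rmult_le_compat_r; unfold C; lra. }
assert (Hcont : forall f y z, field f -> Lipschitz C y -> Lipschitz C z ->
          continuity (fun t => f t (y (clamp a b t)) (z (clamp a b t)))).
{ intros f y z Hf Hy Hz; apply (Lipschitz_continuity (C * (1 + C + C))).
  intros s t; apply Rle_trans with (1 := Hlip f Hf _ _ _ _ _ _).
  rewrite Rmult_assoc; apply Rmult_le_compat_l; [exact HC|].
  assert (Hcl := clamp_Lipschitz a b s t).
  assert (H1 := Hy (clamp a b s) (clamp a b t)); assert (H2 := Hz (clamp a b s) (clamp a b t)).
  assert (H3 := Rmult_le_compat_l C _ _ HC Hcl); lra. }
set (Y := fun n => fst (picard a b y0 z0 f1 f2 n)).
set (Z := fun n => snd (picard a b y0 z0 f1 f2 n)).
set (along := fun (f : R -> R -> R -> R) n t => f t (Y n (clamp a b t)) (Z n (clamp a b t))).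
assert (HLip : forall n, Lipschitz C (Y n) /\ Lipschitz C (Z n)).
{ induction n as [|n [IHY IHZ]].
  - split; intros x x'; unfold Y, Z; simpl; rewrite Rminus_diag, Rabs_R0;
      apply Rmult_le_pos; auto using Rabs_pos.
  - split.
    + apply (primitive_Lipschitz (along f1 n)); [apply Hcont; auto; now left|].
      intros; apply Hbound; now left.
    + apply (primitive_Lipschitz (along f2 n)); [apply Hcont; auto; now right|].
      intros; apply Hbound; now right. }
assert (HdY : forall n x, is_derive (Y (S n)) x (along f1 n x)).
{ intros n x; destruct (HLip n) as [H1 H2]; apply (is_derive_primitive (along f1 n)).
  apply Hcont; auto; now left. }
assert (HdZ : forall n x, is_derive (Z (S n)) x (along f2 n x)).
{ intros n x; destruct (HLip n) as [H1 H2]; apply (is_derive_primitive (along f2 n)).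
  apply Hcont; auto; now right. }
assert (HYa : forall n, Y n a = y0 /\ Z n a = z0).
{ intros [|n]; [now split|]; unfold Y, Z; simpl; rewrite !RInt_point.
  unfold zero; simpl; split; ring. }
set (K := C * (b - a)).
assert (HK : 0 <= K) by (unfold K; nra).
(* In the norm weighted by [exp (4 * C * (x - a))] the Picard map contracts
   by the factor 1/2. *)
set (w := fun n x => K * (1 / 2) ^ n * exp (4 * C * (x - a))).
assert (Hdw : forall n x, is_derive (w n) x (4 * C * w n x)).
{ intros n x; unfold w; auto_derive; [trivial | unfold Rminus; ring]. }
assert (Hw0 : forall n x, 0 <= w n x).
{ intros n x; unfold w; assert (H1 := pow_half_pos n); assert (H2 := exp_pos (4 * C * (x - a))).
  apply Rmult_le_pos; [nra | lra]. }
assert (Hstep : forall n x, a <= x <= b ->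
   Rabs (Y (S n) x - Y n x) <= w n x /\ Rabs (Z (S n) x - Z n x) <= w n x).
{ induction n as [|n IH].
  - intros x Hx.
    assert (Hone : K <= w O x).
    { unfold w; simpl; assert (H := exp_ineq1_le (4 * C * (x - a))).
      assert (0 <= 4 * C * (x - a)) by (apply Rmult_le_pos; lra); nra. }
    assert (HCx : C * Rabs (x - a) <= K).
    { unfold K; apply Rmult_le_compat_l; [exact HC|]; rewrite Rabs_right; lra. }
    destruct (HLip 1%nat) as [H1 H2]; destruct (HYa 1%nat) as [E1 E2].
    specialize (H1 a x); specialize (H2 a x); rewrite E1 in H1; rewrite E2 in H2.
    change (Y O x) with y0; change (Z O x) with z0; lra.
  - assert (Hdiff : forall f, field f -> forall x, a <= x <= b ->
              Rabs (along f (S n) x - along f n x) <= 4 * C * w (S n) x).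
    { intros f Hf x Hx; apply Rle_trans with (1 := Hlip f Hf _ _ _ _ _ _).
      rewrite Rminus_diag, Rabs_R0, (clamp_id a b x Hx); destruct (IH x Hx) as [H1 H2].
      replace (4 * C * w (S n) x) with (C * (0 + w n x + w n x))
        by (unfold w; simpl; field).
      apply Rmult_le_compat_l; lra. }
    destruct (HYa (S (S n))) as [E1 E2]; destruct (HYa (S n)) as [E3 E4].
    assert (HYZ0 := Hw0 (S n) a).
    intros x Hx; split.
    + apply (dominated_by_derive (fun x => Y (S (S n)) x - Y (S n) x)
               (fun x => along f1 (S n) x - along f1 n x) (w (S n))
               (fun x => 4 * C * w (S n) x) a b); auto.
      * intros t _; apply (is_derive_minus (Y (S (S n))) (Y (S n))); apply HdY.
      * apply Hdiff; now left.
      * rewrite E1, E3, Rminus_diag, Rabs_R0; exact HYZ0.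
    + apply (dominated_by_derive (fun x => Z (S (S n)) x - Z (S n) x)
               (fun x => along f2 (S n) x - along f2 n x) (w (S n))
               (fun x => 4 * C * w (S n) x) a b); auto.
      * intros t _; apply (is_derive_minus (Z (S (S n))) (Z (S n))); apply HdZ.
      * apply Hdiff; now right.
      * rewrite E2, E4, Rminus_diag, Rabs_R0; exact HYZ0. }
set (K' := K * exp (4 * C * (b - a))).
assert (HK' : forall n x, a <= x <= b ->
   Rabs (Y (S n) x - Y n x) <= K' * (1 / 2) ^ n /\ Rabs (Z (S n) x - Z n x) <= K' * (1 / 2) ^ n).
{ intros n x Hx; destruct (Hstep n x Hx) as [H1 H2].
  assert (Hwx : w n x <= K' * (1 / 2) ^ n); [|lra].
  unfold w, K'; assert (Hp := pow_half_pos n).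
  assert (He : exp (4 * C * (x - a)) <= exp (4 * C * (b - a))).
  { assert (Harg : 4 * C * (x - a) <= 4 * C * (b - a)) by (apply Rmult_le_compat_l; lra).
    destruct Harg as [Harg | Harg]; [left; now apply exp_increasing | rewrite Harg; lra]. }
  assert (H := Rmult_le_compat_l (K * (1 / 2) ^ n) _ _ ltac:(nra) He); lra. }
set (Yi := fun x => real (Lim_seq (fun n => Y n (clamp a b x)))).
set (Zi := fun x => real (Lim_seq (fun n => Z n (clamp a b x)))).
assert (Hlim : forall n x, Rabs (Yi x - Y n (clamp a b x)) <= 2 * K' * (1 / 2) ^ n /\
                           Rabs (Zi x - Z n (clamp a b x)) <= 2 * K' * (1 / 2) ^ n).
{ intros n x; assert (Hx := clamp_bounds a b x Hab); split.
  - apply (geometric_limit (fun n => Y n (clamp a b x))); intro k; now apply HK'.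
  - apply (geometric_limit (fun n => Z n (clamp a b x))); intro k; now apply HK'. }
assert (HYi : Lipschitz C Yi /\ Lipschitz C Zi).
{ split; intros x x'; apply (le_of_geometric_error _ _ (4 * K')); intros n;
    destruct (HLip n) as [H1 H2]; specialize (H1 (clamp a b x) (clamp a b x'));
    specialize (H2 (clamp a b x) (clamp a b x'));
    assert (Hcl := Rmult_le_compat_l C _ _ HC (clamp_Lipschitz a b x x'));
    destruct (Hlim n x) as [A1 A2]; destruct (Hlim n x') as [B1 B2].
  - replace (Yi x' - Yi x) with ((Yi x' - Y n (clamp a b x'))
      + (Y n (clamp a b x') - Y n (clamp a b x)) + - (Yi x - Y n (clamp a b x))) by ring.
    apply Rle_trans with (1 := Rabs_triang _ _); rewrite Rabs_Ropp.
    assert (T := Rabs_triang (Yi x' - Y n (clamp a b x')) (Y n (clamp a b x') - Y n (clamp a b x))).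
    lra.
  - replace (Zi x' - Zi x) with ((Zi x' - Z n (clamp a b x'))
      + (Z n (clamp a b x') - Z n (clamp a b x)) + - (Zi x - Z n (clamp a b x))) by ring.
    apply Rle_trans with (1 := Rabs_triang _ _); rewrite Rabs_Ropp.
    assert (T := Rabs_triang (Zi x' - Z n (clamp a b x')) (Z n (clamp a b x') - Z n (clamp a b x))).
    lra. }
destruct HYi as [HLY HLZ].
set (alongi := fun (f : R -> R -> R -> R) t => f t (Yi (clamp a b t)) (Zi (clamp a b t))).
assert (Hci : forall f, field f -> continuity (alongi f)) by (intros; now apply Hcont).
set (y := fun x => y0 + RInt (alongi f1) a x).
set (z := fun x => z0 + RInt (alongi f2) a x).
assert (Hclose : forall f, field f -> forall n x, a <= x <= b ->
          Rabs (alongi f x - along f n x) <= 4 * C * K' * (1 / 2) ^ n).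
{ intros f Hf n x Hx; apply Rle_trans with (1 := Hlip f Hf _ _ _ _ _ _).
  destruct (Hlim n x) as [H1 H2]; rewrite Rminus_diag, Rabs_R0.
  rewrite (clamp_id a b x Hx) in *.
  replace (4 * C * K' * (1 / 2) ^ n)
    with (C * (0 + 2 * K' * (1 / 2) ^ n + 2 * K' * (1 / 2) ^ n)) by ring.
  apply Rmult_le_compat_l; lra. }
assert (Hy : forall x, a <= x <= b -> y x = Yi x /\ z x = Zi x).
{ intros x Hx.
  assert (Hyz : forall n, Rabs (y x - Y (S n) x) <= 4 * C * K' * (1 / 2) ^ n * (b - a) /\
                          Rabs (z x - Z (S n) x) <= 4 * C * K' * (1 / 2) ^ n * (b - a)).
  { intros n; destruct (HYa (S n)) as [E1 E2].
    assert (Hpos : 0 <= 4 * C * K' * (1 / 2) ^ n).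
    { apply Rle_trans with (2 := Hclose f1 (or_introl eq_refl) n a ltac:(lra)), Rabs_pos. }
    assert (Hyx : 4 * C * K' * (1 / 2) ^ n * (x - a) <= 4 * C * K' * (1 / 2) ^ n * (b - a))
      by (apply Rmult_le_compat_l; lra).
    assert (Hline : forall t, is_derive (fun t => 4 * C * K' * (1 / 2) ^ n * (t - a)) t
                                (4 * C * K' * (1 / 2) ^ n)).
    { intro t; auto_derive; [trivial | ring]. }
    split; apply Rle_trans with (2 := Hyx).
    - apply (dominated_by_derive (fun t => y t - Y (S n) t)
         (fun t => alongi f1 t - along f1 n t)
         (fun t => 4 * C * K' * (1 / 2) ^ n * (t - a)) (fun _ => 4 * C * K' * (1 / 2) ^ n) a b);
        auto.
      + intros t _; apply (is_derive_minus y (Y (S n))); [|apply HdY].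
        apply is_derive_primitive, Hci; now left.
      + apply Hclose; now left.
      + unfold y; rewrite RInt_point, E1; unfold zero; simpl.
        replace (y0 + 0 - y0) with 0 by ring; rewrite Rabs_R0; lra.
    - apply (dominated_by_derive (fun t => z t - Z (S n) t)
         (fun t => alongi f2 t - along f2 n t)
         (fun t => 4 * C * K' * (1 / 2) ^ n * (t - a)) (fun _ => 4 * C * K' * (1 / 2) ^ n) a b);
        auto.
      + intros t _; apply (is_derive_minus z (Z (S n))); [|apply HdZ].
        apply is_derive_primitive, Hci; now right.
      + apply Hclose; now right.
      + unfold z; rewrite RInt_point, E2; unfold zero; simpl.
        replace (z0 + 0 - z0) with 0 by ring; rewrite Rabs_R0; lra. }
  split; apply Rminus_diag_uniq; apply Rabs_eq_0; apply Rle_antisym; try apply Rabs_pos;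
    apply (le_of_geometric_error _ _ (4 * C * K' * (b - a) + K')); intros n;
    destruct (Hyz n) as [A1 A2]; destruct (Hlim (S n) x) as [B1 B2];
    rewrite (clamp_id a b x Hx) in *.
  - replace (y x - Yi x) with ((y x - Y (S n) x) - (Yi x - Y (S n) x)) by ring.
    apply Rle_trans with (1 := Rabs_triang _ _); rewrite Rabs_Ropp; simpl in B1; lra.
  - replace (z x - Zi x) with ((z x - Z (S n) x) - (Zi x - Z (S n) x)) by ring.
    apply Rle_trans with (1 := Rabs_triang _ _); rewrite Rabs_Ropp; simpl in B2; lra. }
exists y, z; split; [|split].
- unfold y; rewrite RInt_point; unfold zero; simpl; ring.
- unfold z; rewrite RInt_point; unfold zero; simpl; ring.
- intros x Hx; destruct (Hy x Hx) as [E1 E2]; rewrite E1, E2.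
  assert (Ea : forall f, alongi f x = f x (Yi x) (Zi x))
    by (intro f; unfold alongi; now rewrite (clamp_id a b x Hx)).
  rewrite <- !Ea; split; apply is_derive_primitive, Hci; [now left | now right].
Qed.

(** [(y^2 + z^2) exp (- 4 C (x - a))] is nonincreasing. *)
Lemma gronwall (a b C : R) (y z y' z' : R -> R) : 0 <= C ->
  (forall x, a <= x <= b -> is_derive y x (y' x) /\ is_derive z x (z' x)) ->
  (forall x, a <= x <= b -> Rabs (y' x) <= C * (Rabs (y x) + Rabs (z x)) /\
                            Rabs (z' x) <= C * (Rabs (y x) + Rabs (z x))) ->
  forall x, a <= x <= b ->
    y x ^ 2 + z x ^ 2 <= (y a ^ 2 + z a ^ 2) * exp (4 * C * (x - a)).
Proof.
intros HC Hd Hb x Hx.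
set (E := fun t => (y t ^ 2 + z t ^ 2) * exp (- (4 * C * (t - a)))).
assert (HE : - E a <= - E x).
{ apply (increasing_of_derive (fun t => - E t)
    (fun t => exp (- (4 * C * (t - a)))
       * (4 * C * (y t ^ 2 + z t ^ 2) - 2 * (y t * y' t + z t * z' t)))); [lra| |].
  - intros t Ht; destruct (Hd t) as [H1 H2]; [lra|].
    unfold E; auto_derive.
    + repeat split; [exists (y' t); exact H1 | exists (z' t); exact H2].
    + replace (Derive (fun x => y x) t) with (y' t) by (symmetry; now apply is_derive_unique).
      replace (Derive (fun x => z x) t) with (z' t) by (symmetry; now apply is_derive_unique).
      unfold Rminus; ring.
  - intros t Ht; destruct (Hb t) as [H1 H2]; [lra|].
    apply Rmult_le_pos; [left; apply exp_pos|].
    assert (A1 : y t * y' t <= Rabs (y t) * (C * (Rabs (y t) + Rabs (z t)))).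
    { apply Rle_trans with (1 := Rle_abs _); rewrite Rabs_mult.
      apply Rmult_le_compat_l; [apply Rabs_pos | exact H1]. }
    assert (A2 : z t * z' t <= Rabs (z t) * (C * (Rabs (y t) + Rabs (z t)))).
    { apply Rle_trans with (1 := Rle_abs _); rewrite Rabs_mult.
      apply Rmult_le_compat_l; [apply Rabs_pos | exact H2]. }
    rewrite <- (pow2_abs (y t)), <- (pow2_abs (z t)).
    assert (0 <= C * (Rabs (y t) - Rabs (z t)) ^ 2)
      by (apply Rmult_le_pos; [exact HC | apply pow2_ge_0]).
    nra. }
unfold E in HE.
replace (- (4 * C * (a - a))) with 0 in HE by ring; rewrite exp_0 in HE.
rewrite exp_Ropp in HE.
assert (Hp := exp_pos (4 * C * (x - a))).
assert (Hx' : (y x ^ 2 + z x ^ 2) * / exp (4 * C * (x - a)) <= y a ^ 2 + z a ^ 2) by lra.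
apply (Rmult_le_compat_r (exp (4 * C * (x - a)))) in Hx'; [|lra].
rewrite Rmult_assoc, Rinv_l in Hx' by lra; lra.
Qed.

Lemma continuous_dependence (a b : R) (f1 f2 : R -> R -> R -> R) : a <= b -> BL f1 -> BL f2 ->
  exists L, 0 <= L /\ forall y z y' z', solves a b f1 f2 y z -> solves a b f1 f2 y' z' ->
    y' a = y a -> forall x, a <= x <= b ->
    Rabs (y' x - y x) <= L * Rabs (z' a - z a) /\ Rabs (z' x - z x) <= L * Rabs (z' a - z a).
Proof.
intros Hab HB1 HB2.
destruct (BL_Lipschitz _ HB1) as [C1 [HC1 HL1]]; destruct (BL_Lipschitz _ HB2) as [C2 [HC2 HL2]].
set (C := C1 + C2); assert (HC : 0 <= C) by (unfold C; lra).
exists (exp (2 * C * (b - a))); split; [left; apply exp_pos|].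
intros y z y' z' Hyz Hyz' Ha x Hx.
assert (G := gronwall a b C (fun t => y' t - y t) (fun t => z' t - z t)
  (fun t => f1 t (y' t) (z' t) - f1 t (y t) (z t))
  (fun t => f2 t (y' t) (z' t) - f2 t (y t) (z t)) HC).
assert (Hbound : (y' x - y x) ^ 2 + (z' x - z x) ^ 2
          <= ((y' a - y a) ^ 2 + (z' a - z a) ^ 2) * exp (4 * C * (x - a))).
{ apply G; [| |exact Hx].
  - intros t Ht; destruct (Hyz t Ht); destruct (Hyz' t Ht); split.
    + apply (is_derive_minus y' y); assumption.
    + apply (is_derive_minus z' z); assumption.
  - intros t Ht; specialize (HL1 t (y t) (z t) t (y' t) (z' t)).
    specialize (HL2 t (y t) (z t) t (y' t) (z' t)); rewrite Rminus_diag, Rabs_R0, Rplus_0_l in *.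
    assert (Hp1 := Rabs_pos (y' t - y t)); assert (Hp2 := Rabs_pos (z' t - z t)).
    split; [apply Rle_trans with (1 := HL1) | apply Rle_trans with (1 := HL2)];
      apply Rmult_le_compat_r; unfold C; lra. }
rewrite Ha, Rminus_diag in Hbound; clear G.
assert (He : exp (4 * C * (x - a)) <= exp (2 * C * (b - a)) ^ 2).
{ simpl; rewrite Rmult_1_r, <- exp_plus.
  assert (Harg : 4 * C * (x - a) <= 2 * C * (b - a) + 2 * C * (b - a)).
  { assert (C * (x - a) <= C * (b - a)) by (apply Rmult_le_compat_l; lra); lra. }
  destruct Harg as [Harg | Harg]; [left; now apply exp_increasing | rewrite Harg; lra]. }
set (l := exp (2 * C * (b - a))) in *.
assert (Hl : 0 < l) by apply exp_pos.
assert (Hsq : (y' x - y x) ^ 2 + (z' x - z x) ^ 2 <= (l * Rabs (z' a - z a)) ^ 2).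
{ rewrite Rpow_mult_distr, pow2_abs.
  apply Rle_trans with (1 := Hbound).
  assert (Hz := pow2_ge_0 (z' a - z a)); nra. }
assert (Hl0 : 0 <= l * Rabs (z' a - z a)) by (apply Rmult_le_pos; [lra | apply Rabs_pos]).
assert (N1 := pow2_ge_0 (y' x - y x)); assert (N2 := pow2_ge_0 (z' x - z x)).
rewrite <- (Rabs_pos_eq _ Hl0); split; apply Rsqr_le_abs_0; unfold Rsqr; lra.
Qed.

(** * Hyperbolic functions *)

Lemma is_derive_cosh (x : R) : is_derive cosh x (sinh x).
Proof. apply is_derive_Reals, derivable_pt_lim_cosh. Qed.

Lemma is_derive_sinh (x : R) : is_derive sinh x (cosh x).
Proof. apply is_derive_Reals, derivable_pt_lim_sinh. Qed.

Lemma cosh_ge_1 (x : R) : 1 <= cosh x.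
Proof.
unfold cosh; assert (H := exp_pos x); rewrite exp_Ropp.
assert (exp x * / exp x = 1) by (field; lra).
assert (0 < / exp x) by (apply Rinv_0_lt_compat; lra).
assert (0 <= / exp x * (exp x - 1) ^ 2) by (apply Rmult_le_pos; [lra | apply pow2_ge_0]).
nra.
Qed.

Lemma cosh_sinh_sq (x : R) : cosh x ^ 2 = 1 + sinh x ^ 2.
Proof.
unfold cosh, sinh; assert (H := exp_pos x); rewrite exp_Ropp; field; lra.
Qed.

Lemma tanh_sq (u : R) : 1 - tanh u ^ 2 = (/ cosh u) ^ 2.
Proof.
assert (H1 := cosh_ge_1 u); assert (H2 := cosh_sinh_sq u).
unfold tanh; replace (1 - (sinh u / cosh u) ^ 2)
  with ((cosh u ^ 2 - sinh u ^ 2) * (/ cosh u) ^ 2) by (field; lra).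
rewrite H2; ring.
Qed.

Lemma sech_bounds (u : R) : 0 < / cosh u <= 1.
Proof.
assert (H := cosh_ge_1 u); split; [apply Rinv_0_lt_compat; lra|].
rewrite <- Rinv_1; apply Rinv_le_contravar; lra.
Qed.

Lemma tanh_bounds (u : R) : -1 < tanh u < 1.
Proof.
assert (H := tanh_sq u); assert (H1 := sech_bounds u).
assert (0 < (/ cosh u) ^ 2) by (apply pow_lt; lra).
split; nra.
Qed.

Lemma is_derive_tanh (u : R) : is_derive tanh u ((/ cosh u) ^ 2).
Proof.
assert (H1 := cosh_ge_1 u); rewrite <- tanh_sq; unfold tanh.
replace (1 - (sinh u / cosh u) ^ 2)
  with ((cosh u * cosh u - sinh u * sinh u) / cosh u ^ 2) by (field; lra).
apply (is_derive_div sinh cosh); [apply is_derive_sinh | apply is_derive_cosh | lra].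
Qed.

Lemma is_derive_sech (u : R) : is_derive (fun u => / cosh u) u (- (tanh u * / cosh u)).
Proof.
assert (H1 := cosh_ge_1 u).
replace (- (tanh u * / cosh u)) with (- sinh u / cosh u ^ 2) by (unfold tanh; field; lra).
apply (is_derive_inv cosh); [apply is_derive_cosh | lra].
Qed.

Lemma C2on_tanh : C2on tanh (fun u => (/ cosh u) ^ 2) (fun _ => True).
Proof.
apply (C2on_bounded _ _ (fun u => 2 * / cosh u * - (tanh u * / cosh u)) _ 2); trivial.
- intros; apply is_derive_tanh.
- intros u _.
  replace (2 * / cosh u * - (tanh u * / cosh u))
    with (INR 2 * - (tanh u * / cosh u) * (/ cosh u) ^ pred 2) by (simpl; ring).
  apply (is_derive_pow (fun u => / cosh u)), is_derive_sech.
- intros u _; assert (H1 := tanh_bounds u); assert (H2 := sech_bounds u).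
  set (t := tanh u) in *; set (c := / cosh u) in *.
  assert (0 <= c * c <= 1) by nra.
  repeat split; apply Rabs_le; nra.
Qed.

Lemma C2on_sech : C2on (fun u => / cosh u) (fun u => - (tanh u * / cosh u)) (fun _ => True).
Proof.
apply (C2on_bounded _ _
  (fun u => - ((/ cosh u) ^ 2 * / cosh u + tanh u * - (tanh u * / cosh u))) _ 2); trivial.
- intros; apply is_derive_sech.
- intros u _; apply (is_derive_opp (fun u => tanh u * / cosh u)).
  apply (is_derive_mult tanh (fun u => / cosh u));
    [apply is_derive_tanh | apply is_derive_sech | intros; apply Rmult_comm].
- intros u _; assert (H1 := tanh_bounds u); assert (H2 := sech_bounds u).
  set (t := tanh u) in *; set (c := / cosh u) in *.
  assert (0 <= c * c <= 1) by nra.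
  assert (0 <= t * t <= 1) by nra.
  assert (-1 <= t * c <= 1) by (split; nra).
  repeat split; apply Rabs_le; nra.
Qed.

(** * The radius as a function of X^2 - T^2 *)

(** The value of [X^2 - T^2] at the points of radius [r]. *)
Definition level (M r : R) : R := (r - 2 * M) * exp (r / (2 * M)).

Definition rad (M s : R) : R := epsilon (inhabits 0) (fun r => 0 < r /\ level M r = s).

Lemma radius_rad (M T X : R) : radius M T X = rad M (X ^ 2 - T ^ 2).
Proof. reflexivity. Qed.

Lemma level_increasing (M x y : R) : 0 < M -> 0 < x -> x < y -> level M x < level M y.
Proof. exact (is_radius_lt M x y). Qed.

(** This is [exp y * (1 - y) < 1] for [y = r / (2 M) > 0]. *)
Lemma level_gt (M r : R) : 0 < M -> 0 < r -> - 2 * M < level M r.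
Proof.
intros HM Hr; unfold level.
assert (Hp : 0 < r / (2 * M)) by (apply Rdiv_lt_0_compat; lra).
assert (Hlt := exp_ineq1 (- (r / (2 * M))) ltac:(lra)).
rewrite exp_Ropp in Hlt.
assert (He := exp_pos (r / (2 * M))).
assert (Hk : exp (r / (2 * M)) * (1 - r / (2 * M)) < 1).
{ replace 1 with (exp (r / (2 * M)) * / exp (r / (2 * M))) at 2 by (field; lra).
  apply Rmult_lt_compat_l; lra. }
replace ((r - 2 * M) * exp (r / (2 * M)))
  with (- (2 * M) * (exp (r / (2 * M)) * (1 - r / (2 * M)))) by (field; lra).
nra.
Qed.

Lemma rad_spec (M s : R) : 0 < M -> - 2 * M < s -> 0 < rad M s /\ level M (rad M s) = s.
Proof.
intros HM Hs; destruct (Rle_lt_dec 0 s) as [H | H].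
- assert (E : sqrt s ^ 2 - 0 ^ 2 = s) by (rewrite pow2_sqrt by lra; ring).
  rewrite <- E; apply (radius_spec M 0 (sqrt s) HM); unfold in_kruskal; lra.
- assert (E : 0 ^ 2 - sqrt (- s) ^ 2 = s) by (rewrite pow2_sqrt by lra; ring).
  rewrite <- E; apply (radius_spec M (sqrt (- s)) 0 HM); unfold in_kruskal; lra.
Qed.

Lemma rad_level (M r : R) : 0 < M -> 0 < r -> rad M (level M r) = r.
Proof.
intros HM Hr.
destruct (rad_spec M (level M r) HM (level_gt M r HM Hr)) as [Hp He].
destruct (Rtotal_order (rad M (level M r)) r) as [H | [H | H]]; [|exact H|];
  apply (level_increasing M) in H; lra.
Qed.

Lemma rad_lt (M s t : R) : 0 < M -> - 2 * M < s -> s < t -> rad M s < rad M t.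
Proof.
intros HM Hs Hst.
destruct (rad_spec M s HM Hs) as [Hp He].
destruct (rad_spec M t HM ltac:(lra)) as [Hp' He'].
destruct (Rtotal_order (rad M s) (rad M t)) as [H | [H | H]]; [exact H | |].
- rewrite H in He; lra.
- apply (level_increasing M) in H; lra.
Qed.

Lemma rad_le (M s t : R) : 0 < M -> - 2 * M < s -> s <= t -> rad M s <= rad M t.
Proof.
intros HM Hs [H | H]; [left; now apply rad_lt | rewrite H; lra].
Qed.

Lemma is_derive_level (M r : R) : 0 < M ->
  is_derive (level M) r (r * exp (r / (2 * M)) / (2 * M)).
Proof. intros HM; unfold level, Rdiv; auto_derive; [lra | field; lra]. Qed.

(** The derivative of [rad M] at the point where its value is [r]; all
    derivatives along a solution are expressed through the radius in this way. *)
Definition rad' (M r : R) : R := 2 * M * exp (- (r / (2 * M))) / r.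

Definition rad'' (M r : R) : R := - (r + 2 * M) / (2 * M * r) * rad' M r * rad' M r.

Lemma is_derive_rad' (M r : R) : 0 < M -> 0 < r ->
  is_derive (rad' M) r (- (r + 2 * M) / (2 * M * r) * rad' M r).
Proof. intros HM Hr; unfold rad', Rdiv; auto_derive; [lra | field; lra]. Qed.

(** Monotonicity of [level] makes [rad] continuous at [s]; the mean value theorem for
    [level] between the two radii then gives the difference quotient. *)
Lemma is_derive_rad (M s : R) : 0 < M -> - 2 * M < s ->
  is_derive (rad M) s (rad' M (rad M s)).
Proof.
intros HM Hs; apply is_derive_Reals; intros eps Heps.
destruct (rad_spec M s HM Hs) as [Hr He]; set (r := rad M s) in *.
destruct (is_derive_continuity _ _ _ (is_derive_rad' M r HM Hr) eps Heps) as [d [Hd Hc]].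
set (d' := Rmin d r / 2).
assert (Hdr : 0 < Rmin d r) by (apply Rmin_glb_lt; lra).
assert (H1 := Rmin_l d r); assert (H2 := Rmin_r d r).
assert (Hlo := level_increasing M (r - d') r HM ltac:(unfold d'; lra) ltac:(unfold d'; lra)).
assert (Hhi := level_increasing M r (r + d') HM ltac:(lra) ltac:(unfold d'; lra)).
assert (Hlo2 := level_gt M (r - d') HM ltac:(unfold d'; lra)).
assert (Hpos : 0 < Rmin (s - level M (r - d')) (level M (r + d') - s)).
{ apply Rmin_glb_lt; lra. }
exists (mkposreal _ Hpos); intros h Hh0 Hh; simpl in Hh.
assert (K1 := Rmin_l (s - level M (r - d')) (level M (r + d') - s)).
assert (K2 := Rmin_r (s - level M (r - d')) (level M (r + d') - s)).
assert (Hh' := Rabs_def2 _ _ Hh).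
destruct (rad_spec M (s + h) HM ltac:(lra)) as [Hq Heq].
assert (B1 := rad_lt M (level M (r - d')) (s + h) HM Hlo2 ltac:(lra)).
assert (B2 := rad_lt M (s + h) (level M (r + d')) HM ltac:(lra) ltac:(lra)).
rewrite rad_level in B1 by (unfold d'; lra); rewrite rad_level in B2 by (unfold d'; lra).
set (q := rad M (s + h)) in *.
destruct (MVT_gen (level M) r q (fun r => r * exp (r / (2 * M)) / (2 * M))) as [c [Hc1 Hc2]].
{ intros; now apply is_derive_level. }
{ intros x _; exact (is_derive_continuity _ _ _ (is_derive_level M x HM)). }
assert (Hcr : r - d' < c < r + d').
{ revert Hc1; unfold Rmin, Rmax; repeat destruct (Rle_dec _ _); unfold d' in *; lra. }
assert (Hc0 : 0 < c) by (unfold d' in Hcr; lra).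
replace ((q - r) / h) with (rad' M c).
- destruct (Req_dec c r) as [-> | Hne]; [rewrite Rminus_diag, Rabs_R0; exact Heps|].
  apply Hc; split; [split; [exact I | lra]|].
  apply Rabs_def1; unfold d' in Hcr; lra.
- assert (Hee := exp_pos (c / (2 * M))).
  unfold rad'; rewrite exp_Ropp.
  replace h with (c * exp (c / (2 * M)) / (2 * M) * (q - r)).
  + field; repeat split; try lra.
    intro Hqr; apply Hh0; rewrite Hqr in Hc2; lra.
  + rewrite Rmult_comm; rewrite Rmult_comm in Hc2; rewrite <- Hc2; lra.
Qed.

(** * The equation in terms of the rapidity *)

Definition Acoef (M r : R) : R := exp (- (r / (2 * M))) * (6 * M / r ^ 2 - 1 / r).

(** Up to the factor [4 M] this is the square root of the conformal factor of the
    metric in the [(T, X)] plane. *)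
Definition root_exp (M r : R) : R := exp (- (r / (4 * M))) / sqrt r.

Definition Bcoef (M H r : R) : R := 12 * H * M * root_exp M r.

Definition slope (_ _ u : R) : R := tanh u.

Definition accel (M H X F u : R) : R :=
  let r := rad M (X ^ 2 - F ^ 2) in
  Acoef M r * (F - X * tanh u) - Bcoef M H r * / cosh u.

Lemma is_derive_root_exp (M r : R) : 0 < M -> 0 < r ->
  is_derive (root_exp M) r (- root_exp M r * (/ (4 * M) + / (2 * r))).
Proof.
intros HM Hr; unfold root_exp, Rdiv.
assert (Hs : 0 < sqrt r) by now apply sqrt_lt_R0.
auto_derive; [repeat split; lra|].
set (e := exp _); assert (E := sqrt_sqrt r ltac:(lra)).
set (q := sqrt r) in *; rewrite <- E; field; lra.
Qed.

Lemma C2on_rad (M a b : R) : 0 < M -> - 2 * M < a ->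
  C2on (rad M) (fun s => rad' M (rad M s)) (fun s => a <= s <= b).
Proof.
intros HM Ha.
assert (Hd2 : forall s, a <= s <= b ->
          is_derive (fun s => rad' M (rad M s)) s (rad'' M (rad M s))).
{ intros s Hs; destruct (rad_spec M s HM ltac:(lra)) as [Hr _].
  unfold rad''; rewrite Rmult_comm.
  apply (is_derive_comp (rad' M) (rad M));
    [now apply is_derive_rad' | apply is_derive_rad; lra]. }
apply (C2on_interval _ _ (fun s => rad'' M (rad M s))).
- intros; apply is_derive_rad; lra.
- exact Hd2.
- intros s Hs; destruct (rad_spec M s HM ltac:(lra)) as [Hr _].
  apply (continuity_pt_comp (rad M) (rad'' M)).
  + apply (is_derive_continuity _ _ _ (is_derive_rad M s HM ltac:(lra))).
  + eapply is_derive_continuity; unfold rad'', rad'; auto_derive; [|reflexivity].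
    repeat split; nra.
Qed.

Lemma C2on_exp (k a b : R) :
  C2on (fun r => exp (- (r / k))) (fun r => - / k * exp (- (r / k)))
    (fun r => a <= r <= b).
Proof.
apply (C2on_interval _ _ (fun r => / k * / k * exp (- (r / k)))).
- intros; unfold Rdiv; auto_derive; [trivial | ring].
- intros; unfold Rdiv; auto_derive; [trivial | ring].
- intros; eapply is_derive_continuity; unfold Rdiv; auto_derive; [trivial | reflexivity].
Qed.

Lemma C2on_inv (a b : R) : 0 < a ->
  C2on Rinv (fun r => - / r ^ 2) (fun r => a <= r <= b).
Proof.
intros Ha; apply (C2on_interval _ _ (fun r => 2 / r ^ 3)).
- intros; auto_derive; [lra | field; lra].
- intros x Hx; assert (Hx2 : x <> 0) by lra.
  auto_derive; [nra | field; lra].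
- intros x Hx; eapply is_derive_continuity; auto_derive; [|reflexivity].
  repeat apply Rmult_integral_contrapositive_currified; lra.
Qed.

Lemma C2on_root_exp (M a b : R) : 0 < M -> 0 < a ->
  C2on (root_exp M) (fun r => - root_exp M r * (/ (4 * M) + / (2 * r)))
    (fun r => a <= r <= b).
Proof.
intros HM Ha.
apply (C2on_interval _ _
  (fun r => root_exp M r * ((/ (4 * M) + / (2 * r)) ^ 2 + / (2 * r ^ 2)))).
- intros; apply is_derive_root_exp; lra.
- intros x Hx; assert (Hd := is_derive_root_exp M x HM ltac:(lra)).
  auto_derive.
  + repeat split; try lra; eexists; exact Hd.
  + replace (Derive (fun x0 => root_exp M x0) x)
      with (- root_exp M x * (/ (4 * M) + / (2 * x)))
      by (symmetry; now apply is_derive_unique).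
    field; lra.
- intros x Hx; assert (Hd := is_derive_root_exp M x HM ltac:(lra)).
  eapply is_derive_continuity; auto_derive; [|reflexivity].
  assert (x * (x * 1) <> 0) by nra.
  repeat split; try lra; eexists; exact Hd.
Qed.

Lemma BL_slope : BL slope.
Proof.
exact (BL_comp tanh _ (fun _ => True) (fun _ _ z => z) C2on_tanh (fun _ _ _ => I) Lipschitz_third).
Qed.

(** * The truncated equation *)

(** Truncation at [s >= s0] keeps the radius away from [0]. The bounds on [X],
    on [F] and from above on [s] hold on every solution considered, and only make
    the field bounded and Lipschitz on the whole space. *)
Definition accel_cut (M H X0 K s0 X F u : R) : R :=
  let x := clamp (- X0) X0 X in
  let f := clamp (- K) K F in
  let r := rad M (clamp s0 (X0 ^ 2) (x ^ 2 - f ^ 2)) in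
  Acoef M r * (f - x * tanh u) - Bcoef M H r * / cosh u.

Lemma BL_accel_cut (M H X0 K s0 : R) : 0 < M -> 0 < X0 -> 0 <= K -> - 2 * M < s0 <= X0 ^ 2 ->
  BL (accel_cut M H X0 K s0).
Proof.
intros HM HX0 HK Hs0.
set (x := fun X (_ _ : R) => clamp (- X0) X0 X).
set (f := fun (_ F _ : R) => clamp (- K) K F).
assert (Hx : BL x).
{ apply (BL_clamp _ _ (fun X _ _ => X)); [lra|]; apply Lipschitz_var; intros.
  assert (H1 := Rabs_pos (y' - y)); assert (H2 := Rabs_pos (z' - z)); lra. }
assert (Hf : BL f).
{ apply (BL_clamp _ _ (fun _ F _ => F)); [lra|]; apply Lipschitz_var; intros.
  assert (H1 := Rabs_pos (x' - x0)); assert (H2 := Rabs_pos (z' - z)); lra. }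
set (s := fun X F u => x X F u * x X F u + -1 * (f X F u * f X F u)).
assert (Hs : BL s).
{ apply BL_plus; [now apply BL_mult|]; apply BL_mult; [apply BL_const|].
  now apply BL_mult. }
set (sc := fun X F u => clamp s0 (X0 ^ 2) (s X F u)).
assert (Hsc : BL sc) by (apply BL_clamp; [lra | now apply BL_Lipschitz]).
assert (Hr : BL (fun X F u => rad M (sc X F u))).
{ apply (BL_comp _ _ _ sc (C2on_rad M s0 (X0 ^ 2) HM (proj1 Hs0))).
  - intros; apply clamp_bounds; lra.
  - now apply BL_Lipschitz. }
assert (Hr0 : 0 < rad M s0) by (apply rad_spec; lra).
assert (Hrange : forall X F u, rad M s0 <= rad M (sc X F u) <= rad M (X0 ^ 2)).
{ intros X F u; assert (Hb := clamp_bounds s0 (X0 ^ 2) (s X F u) ltac:(lra)).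
  fold (sc X F u) in Hb; split; apply rad_le; lra. }
assert (He : BL (fun X F u => exp (- (rad M (sc X F u) / (2 * M))))).
{ apply (BL_comp (fun r => exp (- (r / (2 * M)))) _ _ (fun X F u => rad M (sc X F u))
           (C2on_exp (2 * M) (rad M s0) (rad M (X0 ^ 2))) Hrange).
  now apply BL_Lipschitz. }
assert (Hi : BL (fun X F u => / rad M (sc X F u))).
{ apply (BL_comp Rinv _ _ (fun X F u => rad M (sc X F u))
           (C2on_inv (rad M s0) (rad M (X0 ^ 2)) Hr0) Hrange).
  now apply BL_Lipschitz. }
assert (Hq : BL (fun X F u => root_exp M (rad M (sc X F u)))).
{ apply (BL_comp (root_exp M) _ _ (fun X F u => rad M (sc X F u))
           (C2on_root_exp M (rad M s0) (rad M (X0 ^ 2)) HM Hr0) Hrange).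
  now apply BL_Lipschitz. }
assert (Hsech : BL (fun _ _ u => / cosh u)).
{ exact (BL_comp _ _ (fun _ => True) (fun _ _ z => z) C2on_sech (fun _ _ _ => I) Lipschitz_third). }
apply (BL_ext (fun X F u =>
  (exp (- (rad M (sc X F u) / (2 * M)))
     * (6 * M * (/ rad M (sc X F u) * / rad M (sc X F u)) + -1 * / rad M (sc X F u)))
  * (f X F u + -1 * (x X F u * slope X F u))
  + -1 * ((12 * H * M * root_exp M (rad M (sc X F u))) * / cosh u))).
- intros X F u; unfold accel_cut, Acoef, Bcoef, slope.
  replace (clamp s0 (X0 ^ 2) (clamp (- X0) X0 X ^ 2 - clamp (- K) K F ^ 2))
    with (sc X F u) by (unfold sc, s, x, f; f_equal; ring).
  assert (H1 := Hrange X F u); fold (x X F u); fold (f X F u); set (r := rad M (sc X F u)) in *.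
  assert (Hc := cosh_ge_1 u); unfold Rdiv; field; lra.
- repeat first [ assumption | apply BL_const | apply BL_slope | apply BL_plus | apply BL_mult ].
Qed.

Lemma accel_cut_eq (M H X0 K s0 X F u : R) : - X0 <= X <= X0 -> - K <= F <= K ->
  s0 <= X ^ 2 - F ^ 2 -> accel_cut M H X0 K s0 X F u = accel M H X F u.
Proof.
intros HX HF Hs; unfold accel_cut, accel.
rewrite (clamp_id (- X0) X0 X HX), (clamp_id (- K) K F HF), clamp_id; [reflexivity|].
split; [exact Hs | nra].
Qed.

Lemma solves_accel_of_cut (M H X0 K s0 : R) (F u : R -> R) :
  (forall x, - X0 <= x <= X0 -> - K <= F x <= K /\ s0 <= x ^ 2 - F x ^ 2) ->
  solves (- X0) X0 slope (accel_cut M H X0 K s0) F u <->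
  solves (- X0) X0 slope (accel M H) F u.
Proof.
intros Hin; split; intros Hsol x Hx; destruct (Hin x Hx) as [HF Hs];
  destruct (Hsol x Hx) as [H1 H2]; split; try exact H1.
- rewrite <- (accel_cut_eq M H X0 K s0 x (F x) (u x) Hx HF Hs); exact H2.
- rewrite (accel_cut_eq M H X0 K s0 x (F x) (u x) Hx HF Hs); exact H2.
Qed.

(** * The singularity is a barrier *)

(** As [r] tends to [0] the first coefficient grows like [r^-2] and the second
    only like [r^(-1/2)], while [F (F - X tanh u) >= (F^2 - X^2) / 2 >= M / 2]. *)
Lemma steep_near_singularity (M H K r X F u : R) :
  0 < M -> 0 < r <= 1 -> r <= M -> r * (12 * Rabs H * M * K + 1) < M ^ 2 ->
  X ^ 2 - F ^ 2 <= - M -> Rabs F <= K ->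
  1 < F * (Acoef M r * (F - X * tanh u) - Bcoef M H r * / cosh u).
Proof.
intros HM Hr HrM Hsmall Hs HF.
assert (HK : 0 <= K) by (apply Rle_trans with (2 := HF), Rabs_pos).
assert (Ht := tanh_bounds u); assert (Hc := sech_bounds u).
assert (HA : 5 * M / 2 <= Acoef M r * r ^ 2).
{ unfold Acoef.
  replace (exp (- (r / (2 * M))) * (6 * M / r ^ 2 - 1 / r) * r ^ 2)
    with (exp (- (r / (2 * M))) * (6 * M - r)) by (field; lra).
  assert (He := exp_ineq1_le (- (r / (2 * M)))).
  assert (Hq : r / (2 * M) <= 1 / 2).
  { apply Rmult_le_reg_r with (2 * M); [lra|].
    unfold Rdiv at 1; rewrite Rmult_assoc, Rinv_l by lra; lra. }
  assert (1 / 2 * (5 * M) <= exp (- (r / (2 * M))) * (6 * M - r))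
    by (apply Rmult_le_compat; lra).
  lra. }
assert (HFX : M / 2 <= F * (F - X * tanh u)).
{ assert (Hsq : (X * tanh u) ^ 2 <= X ^ 2).
  { rewrite Rpow_mult_distr; assert (Hx2 := pow2_ge_0 X).
    assert (tanh u ^ 2 <= 1) by nra; nra. }
  assert (0 <= (F - X * tanh u) ^ 2) by apply pow2_ge_0; nra. }
assert (HB : Rabs (F * (root_exp M r * / cosh u)) * r <= K).
{ assert (Hq : 0 <= root_exp M r * r <= 1).
  { unfold root_exp.
    assert (He : exp (- (r / (4 * M))) <= 1).
    { rewrite <- exp_0; left; apply exp_increasing.
      assert (0 < r / (4 * M)) by (apply Rdiv_lt_0_compat; lra); lra. }
    assert (Hep := exp_pos (- (r / (4 * M)))).
    assert (Hsq : 0 < sqrt r) by (apply sqrt_lt_R0; lra).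
    assert (Hss := sqrt_sqrt r ltac:(lra)).
    assert (Hs1 : sqrt r <= 1) by (rewrite <- sqrt_1; apply sqrt_le_1; lra).
    replace (exp (- (r / (4 * M))) / sqrt r * r) with (exp (- (r / (4 * M))) * sqrt r).
    - split; nra.
    - set (e := exp _) in *; set (q := sqrt r) in *; rewrite <- Hss; field; lra. }
  rewrite Rabs_mult, Rmult_assoc.
  replace (Rabs (root_exp M r * / cosh u) * r) with (root_exp M r * r * / cosh u).
  - assert (0 <= root_exp M r * r * / cosh u <= 1) by (split; nra).
    assert (HpF := Rabs_pos F); nra.
  - rewrite Rabs_right; [ring|].
    apply Rle_ge; apply Rmult_le_pos; [|lra].
    apply Rmult_le_reg_r with r; lra. }
assert (Hr2 : 0 < r ^ 2) by nra.
apply Rmult_lt_reg_r with (r ^ 2); [exact Hr2|].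
replace (F * (Acoef M r * (F - X * tanh u) - Bcoef M H r * / cosh u) * r ^ 2)
  with (Acoef M r * r ^ 2 * (F * (F - X * tanh u))
        - 12 * M * (H * (F * (root_exp M r * / cosh u)) * r) * r)
  by (unfold Bcoef; ring).
assert (H1 : 5 * M / 2 * (M / 2) <= Acoef M r * r ^ 2 * (F * (F - X * tanh u)))
  by (apply Rmult_le_compat; lra).
assert (H2 : H * (F * (root_exp M r * / cosh u)) * r <= Rabs H * K).
{ apply Rle_trans with (1 := Rle_abs _).
  rewrite Rmult_assoc, Rabs_mult; apply Rmult_le_compat_l; [apply Rabs_pos|].
  rewrite Rabs_mult, (Rabs_right r) by lra; exact HB. }
assert (H3 : 12 * M * (H * (F * (root_exp M r * / cosh u)) * r) * r <= 12 * M * (Rabs H * K) * r).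
{ apply Rmult_le_compat_r; [lra|]; apply Rmult_le_compat_l; lra. }
nra.
Qed.

(** The radius is taken at [s] rather than at [X^2 - F^2] so that the estimate
    covers both the equation and its truncation at [s0]. *)
Lemma barrier_levels (M H X0 T0 K : R) : 0 < M -> 0 <= K -> in_kruskal M T0 X0 ->
  exists s0 s1, - 2 * M < s0 < s1 /\ s1 < X0 ^ 2 - T0 ^ 2 /\
    forall s X F u, - 2 * M < s <= s1 -> X ^ 2 - F ^ 2 <= s1 -> Rabs F <= K ->
      1 < F * (Acoef M (rad M s) * (F - X * tanh u) - Bcoef M H (rad M s) * / cosh u).
Proof.
intros HM HK Hin; unfold in_kruskal in Hin.
set (rb := rad M (X0 ^ 2 - T0 ^ 2)).
destruct (rad_spec M (X0 ^ 2 - T0 ^ 2) HM ltac:(lra)) as [Hrb Hlb]; fold rb in Hrb, Hlb.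
set (Q := 12 * Rabs H * M * K + 1).
assert (HQ : 1 <= Q).
{ unfold Q; assert (0 <= Rabs H * (M * K)) by (apply Rmult_le_pos; [apply Rabs_pos | nra]); lra. }
(* The radius below which the field is steep; it is also smaller than the
   radius [rb] of the boundary points. *)
set (r1 := Rmin (Rmin 1 M) (Rmin (M ^ 2 / (2 * Q)) (rb / 2))).
assert (HMQ : 0 < M ^ 2 / (2 * Q)) by (apply Rdiv_lt_0_compat; nra).
assert (Hr1 : 0 < r1) by (unfold r1; repeat apply Rmin_glb_lt; lra).
assert (A1 := Rmin_l (Rmin 1 M) (Rmin (M ^ 2 / (2 * Q)) (rb / 2))).
assert (A2 := Rmin_r (Rmin 1 M) (Rmin (M ^ 2 / (2 * Q)) (rb / 2))).
fold r1 in A1, A2.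
assert (A3 := Rmin_l 1 M); assert (A4 := Rmin_r 1 M).
assert (A5 := Rmin_l (M ^ 2 / (2 * Q)) (rb / 2)).
assert (A6 := Rmin_r (M ^ 2 / (2 * Q)) (rb / 2)).
exists (level M (r1 / 2)), (level M r1).
split; [split; [apply level_gt; lra | apply level_increasing; lra]|].
split; [rewrite <- Hlb; apply level_increasing; lra|].
intros s X F u Hs HXF HF.
destruct (rad_spec M s HM (proj1 Hs)) as [Hr Hle].
assert (Hrr : rad M s <= r1).
{ rewrite <- (rad_level M r1 HM Hr1); apply rad_le; lra. }
apply (steep_near_singularity M H K (rad M s)); try lra.
- fold Q; apply Rle_lt_trans with (M ^ 2 / (2 * Q) * Q).
  + apply Rmult_le_compat_r; lra.
  + replace (M ^ 2 / (2 * Q) * Q) with (M ^ 2 / 2) by (field; lra); nra.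
- apply Rle_trans with (1 := HXF); unfold level.
  assert (Hp : 0 < r1 / (2 * M)) by (apply Rdiv_lt_0_compat; lra).
  assert (He := exp_ineq1_le (r1 / (2 * M))); nra.
Qed.

(** [s = x^2 - F^2] has second derivative [2 (1 - F u') / cosh^2 u], negative
    where [s <= s1], so its minimum cannot be an interior point with [s <= s1]. *)
Lemma barrier (a b s1 : R) (F u u' : R -> R) : a <= b ->
  (forall x, a <= x <= b -> is_derive F x (tanh (u x)) /\ is_derive u x (u' x)) ->
  (forall x, a <= x <= b -> x ^ 2 - F x ^ 2 <= s1 -> 1 < F x * u' x) ->
  s1 < a ^ 2 - F a ^ 2 -> s1 < b ^ 2 - F b ^ 2 ->
  forall x, a <= x <= b -> s1 < x ^ 2 - F x ^ 2.
Proof.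
intros Hab Hd Hsteep Ha Hb.
set (s := fun x => x ^ 2 - F x ^ 2).
set (s' := fun x => 2 * (x - F x * tanh (u x))).
assert (Hs : forall x, a <= x <= b -> is_derive s x (s' x)).
{ intros x Hx; destruct (Hd x Hx) as [H1 _]; unfold s, s'; auto_derive.
  - eexists; exact H1.
  - replace (Derive (fun x => F x) x) with (tanh (u x)) by (symmetry; now apply is_derive_unique).
    ring. }
destruct (continuity_ab_min s a b Hab) as [m [Hmin Hm]].
{ intros x Hx; exact (is_derive_continuity _ _ _ (Hs x Hx)). }
cut (s1 < s m); [intros Hsm x Hx; specialize (Hmin x Hx); unfold s in *; lra|].
destruct (Rlt_le_dec s1 (s m)) as [Hlt | Hle]; [exact Hlt | exfalso].
assert (Hm' : a < m < b).
{ split; apply Rnot_le_lt; intros Hc.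
  - assert (m = a) by lra; subst m; unfold s in Hle; lra.
  - assert (m = b) by lra; subst m; unfold s in Hle; lra. }
destruct (Hd m Hm) as [H1 H2]; specialize (Hsteep m Hm Hle).
apply (minimum_second_derivative s s' a b m (2 * (/ cosh (u m)) ^ 2 * (1 - F m * u' m)));
  try assumption.
- replace (2 * (/ cosh (u m)) ^ 2 * (1 - F m * u' m))
    with (2 * (1 - (tanh (u m) * tanh (u m) + F m * (u' m * (/ cosh (u m)) ^ 2)))).
  + apply (is_derive_scal (fun x => x - F x * tanh (u x))).
    apply (is_derive_minus (fun x => x) (fun x => F x * tanh (u x)) m 1);
      [apply (is_derive_id (K := R_AbsRing))|].
    apply (is_derive_mult F (fun x => tanh (u x))); [exact H1 | | intros; apply Rmult_comm].
    apply (is_derive_comp tanh u); [apply is_derive_tanh | exact H2].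
  + rewrite <- tanh_sq; ring.
- assert (0 < (/ cosh (u m)) ^ 2) by (apply pow_lt, sech_bounds); nra.
Qed.

(** * The Jacobi equation *)

(** As long as [P > p0 / 2] the function [N] increases, hence is nonnegative,
    hence [P] loses at most [eps (b - a) <= p0 / 4]; so [P] never comes down to
    [p0 / 2]. *)
Lemma cooperative_positive (a b m eps p0 : R) (N N' P P' alpha beta : R -> R) :
  0 < m -> 0 < p0 -> eps * (b - a) <= p0 / 4 -> eps < m * p0 / 2 ->
  (forall x, a <= x <= b -> is_derive N x (N' x) /\ is_derive P x (P' x)) ->
  (forall x, a <= x <= b -> m <= alpha x /\ 0 <= beta x /\
     alpha x * P x - eps <= N' x /\ beta x * N x - eps <= P' x) ->
  0 <= N a -> P a = p0 -> forall x, a < x <= b -> 0 < N x.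
Proof.
intros Hm Hp0 He1 He2 Hd Hineq HNa HPa.
assert (Hgrow : forall c, a <= c <= b -> (forall x, a <= x < c -> p0 / 2 < P x) ->
          p0 / 2 <= P c -> forall x, a < x <= c -> 0 < N x).
{ intros c Hc HP HPc x Hx.
  destruct (mean_value N N' a x) as [y [Hy E]]; [lra | intros; apply Hd; lra|].
  destruct (Hineq y) as [Ha [_ [HN _]]]; [lra|].
  assert (HPy : p0 / 2 <= P y).
  { destruct (Req_dec y c) as [-> | Hne]; [exact HPc | left; apply HP; lra]. }
  assert (m * (p0 / 2) <= alpha y * P y) by (apply Rmult_le_compat; lra).
  assert (0 < N' y * (x - a)) by (apply Rmult_lt_0_compat; lra); lra. }
assert (HP : forall x, a <= x <= b -> p0 / 2 < P x).
{ intros x Hx; destruct (Rlt_le_dec (p0 / 2) (P x)) as [H | H]; [exact H | exfalso].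
  destruct (first_hitting P a x (p0 / 2)) as [c [Hc [HPc Hbefore]]]; try lra.
  { intros y Hy; apply (is_derive_continuity P y (P' y)), Hd; lra. }
  destruct (mean_value P P' a c) as [y [Hy E]]; [lra | intros; apply Hd; lra|].
  destruct (Hineq y) as [_ [Hb [_ HPy]]]; [lra|].
  assert (HNy : 0 <= N y).
  { destruct (Req_dec y a) as [-> | Hne]; [exact HNa|].
    left; apply (Hgrow c); try lra; exact Hbefore. }
  assert (0 <= beta y * N y) by (apply Rmult_le_pos; lra).
  assert (Hmin : - eps * (c - a) <= P' y * (c - a)) by (apply Rmult_le_compat_r; lra).
  destruct (Rle_lt_dec 0 eps).
  - assert (eps * (c - a) <= eps * (b - a)) by (apply Rmult_le_compat_l; lra); lra.
  - nra. }
intros x Hx; apply (Hgrow b); try lra.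
- intros y Hy; apply HP; lra.
- left; apply HP; lra.
Qed.

Definition Acoef' (M r : R) : R :=
  exp (- (r / (2 * M))) * (/ (2 * M * r) - 2 / r ^ 2 - 12 * M / r ^ 3).

Definition Bcoef' (M H r : R) : R := - Bcoef M H r * (/ (4 * M) + / (2 * r)).

(** With [Y = F cosh u - X sinh u], [jcoef M r * Y] is twice the principal
    curvature of the hypersurface along the spheres, times the square root of the
    conformal factor of the metric. *)
Definition jcoef (M r : R) : R := 8 * M * exp (- (r / (2 * M))) / r ^ 2.

Definition jcoef' (M r : R) : R := - (jcoef M r * (/ (2 * M) + 2 / r)).

Lemma is_derive_Acoef (M r : R) : 0 < M -> 0 < r -> is_derive (Acoef M) r (Acoef' M r).
Proof.
intros HM Hr; unfold Acoef, Acoef', Rdiv; auto_derive; [repeat split; nra | field; lra].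
Qed.

Lemma is_derive_Bcoef (M H r : R) : 0 < M -> 0 < r ->
  is_derive (Bcoef M H) r (Bcoef' M H r).
Proof.
intros HM Hr; unfold Bcoef', Bcoef.
replace (- (12 * H * M * root_exp M r) * (/ (4 * M) + / (2 * r)))
  with (12 * H * M * (- root_exp M r * (/ (4 * M) + / (2 * r)))) by ring.
apply (is_derive_scal (root_exp M)); now apply is_derive_root_exp.
Qed.

Lemma is_derive_jcoef (M r : R) : 0 < M -> 0 < r -> is_derive (jcoef M) r (jcoef' M r).
Proof.
intros HM Hr; unfold jcoef', jcoef, Rdiv; auto_derive; [repeat split; nra | field; lra].
Qed.

(** The differential of [accel] at [(F, u)] in the direction [(D, W)]. *)
Definition lin_accel (M H X F u r D W : R) : R :=
  let dr := rad' M r * (- 2 * F * D) in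
  Acoef' M r * dr * (F - X * tanh u) + Acoef M r * (D - X * ((/ cosh u) ^ 2 * W))
  - (Bcoef' M H r * dr * / cosh u + Bcoef M H r * (- (tanh u * / cosh u) * W)).

(** [W + kappa * D] is, up to a factor, the derivative of the lapse of the
    variation [(D, W)]. It vanishes when the variation moves the curve along its
    normal geodesics. *)
Definition kappa (M H X F u r : R) : R :=
  Acoef M r * X - Bcoef M H r * sinh u
  - jcoef M r * (cosh u * (X * cosh u - F * sinh u)).

(** The squared norm of the second fundamental form, whose eigenvalues are
    [3 H - 2 mu], [mu], [mu], times the conformal factor. *)
Definition stability (M H X F u r : R) : R :=
  (Bcoef M H r - jcoef M r * (F * cosh u - X * sinh u)) ^ 2
  + (jcoef M r * (F * cosh u - X * sinh u)) ^ 2 / 2.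

(** [k'] is the derivative of [kappa] along a solution. The two sides differ by
    a multiple of [e (X^2 - F^2) - (r - 2 M)] with [e = exp (- r / (2 M))], which
    vanishes by the definition of the radius; the rest is an identity between
    rational functions of [exp u]. *)
Lemma jacobi_potential (M H X F u r : R) : 0 < M -> 0 < r -> level M r = X ^ 2 - F ^ 2 ->
  let t := tanh u in
  let r' := rad' M r * (2 * (X - F * t)) in
  let u' := Acoef M r * (F - X * t) - Bcoef M H r * / cosh u in
  let k' := Acoef' M r * r' * X + Acoef M r
    - (Bcoef' M H r * r' * sinh u + Bcoef M H r * (cosh u * u'))
    - (jcoef' M r * r' * (cosh u * (X * cosh u - F * sinh u))
       + jcoef M r * (sinh u * u' * (X * cosh u - F * sinh u)
         + cosh u * (cosh u + X * (sinh u * u') - (t * sinh u + F * (cosh u * u'))))) in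
  2 * r' * kappa M H X F u r + r * k' + r * lin_accel M H X F u r 1 0
    = r * stability M H X F u r.
Proof.
intros HM Hr Hlev; cbv zeta.
assert (Hlev' : r - 2 * M = exp (- (r / (2 * M))) * (X ^ 2 - F ^ 2)).
{ rewrite <- Hlev, exp_Ropp; unfold level; assert (Hp := exp_pos (r / (2 * M))); field; lra. }
apply Rminus_diag_uniq.
apply eq_trans with (2 * exp (- (r / (2 * M))) / r
  * (exp (- (r / (2 * M))) * (X ^ 2 - F ^ 2) - (r - 2 * M))); [|rewrite Hlev'; ring].
clear Hlev Hlev'.
unfold lin_accel, kappa, stability, jcoef', jcoef, Acoef', Acoef, Bcoef', Bcoef, rad', tanh.
set (e := exp _); set (q := root_exp M r).
assert (Hx := exp_pos u); unfold cosh, sinh; rewrite exp_Ropp; set (x := exp u) in *.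
field; repeat split; try lra; nra.
Qed.

(** The first identity cancels the terms in [W] in the derivative of
    [r^2 (W + kappa D)]; the second says that [root_exp * cosh u] is an integrating
    factor for the equation of [D]. *)
Lemma jacobi_drift (M H X F u r : R) : 0 < M -> 0 < r ->
  let t := tanh u in
  let u' := Acoef M r * (F - X * t) - Bcoef M H r * / cosh u in
  2 * (rad' M r * (2 * (X - F * t)))
    + r * (kappa M H X F u r * (/ cosh u) ^ 2
           - (Acoef M r * X * (/ cosh u) ^ 2 - Bcoef M H r * (t * / cosh u))) = 0 /\
  kappa M H X F u r * (/ cosh u) ^ 2
    = t * u' - (/ (4 * M) + / (2 * r)) * (rad' M r * (2 * (X - F * t))).
Proof.
intros HM Hr; cbv zeta; assert (Hc := cosh_ge_1 u); assert (Hcs := cosh_sinh_sq u).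
unfold kappa, jcoef, Acoef, Bcoef, rad', tanh; set (e := exp _).
split; [field; lra|].
apply Rminus_diag_uniq.
apply eq_trans with (((1 + sinh u ^ 2) - cosh u ^ 2) * (X * (e * (6 * M / r ^ 2 - 1 / r))) * (/ cosh u) ^ 2);
  [|rewrite Hcs; ring].
field; lra.
Qed.

Lemma is_derive_kappa_form (A B J ch sh F : R -> R) (x dA dB dJ dch dsh dF : R) :
  is_derive A x dA -> is_derive B x dB -> is_derive J x dJ ->
  is_derive ch x dch -> is_derive sh x dsh -> is_derive F x dF ->
  is_derive (fun x => A x * x - B x * sh x - J x * (ch x * (x * ch x - F x * sh x))) x
    (dA * x + A x - (dB * sh x + B x * dsh)
     - (dJ * (ch x * (x * ch x - F x * sh x))
        + J x * (dch * (x * ch x - F x * sh x)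
                 + ch x * (ch x + x * dch - (dF * sh x + F x * dsh))))).
Proof.
intros HA HB HJ Hch Hsh HF; auto_derive; [repeat split; eexists; eassumption|].
use_derive HA; use_derive HB; use_derive HJ; use_derive Hch; use_derive Hsh; use_derive HF.
ring.
Qed.

(** [m D] is the lapse of the variation and [P] is [r^2] times its derivative in
    arclength, up to constants. The terms [eD] and [eW] measure the failure of
    [(D, W)] to solve the linearized equation exactly. *)
Lemma jacobi_system (M H x D' W' : R) (F u D W : R -> R) : 0 < M ->
  - 2 * M < x ^ 2 - F x ^ 2 ->
  is_derive F x (tanh (u x)) -> is_derive u x (accel M H x (F x) (u x)) ->
  is_derive D x D' -> is_derive W x W' ->
  let r := fun x => rad M (x ^ 2 - F x ^ 2) in
  let k := fun x => kappa M H x (F x) (u x) (r x) in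
  let m := fun x => root_exp M (r x) * cosh (u x) in
  let P := fun x => r x ^ 2 * (W x + k x * D x) in
  let eD := D' - (/ cosh (u x)) ^ 2 * W x in
  let eW := W' - lin_accel M H x (F x) (u x) (r x) (D x) (W x) in
  ex_derive r x /\ ex_derive k x /\ ex_derive m x /\
  is_derive (fun x => m x * D x) x
    (root_exp M (r x) / (r x ^ 2 * cosh (u x)) * P x + m x * eD) /\
  is_derive P x (r x ^ 2 * stability M H x (F x) (u x) (r x) * D x
                 + (r x ^ 2 * eW + r x ^ 2 * k x * eD)).
Proof.
intros HM Hs HF Hu HD HW r k m P eD eW.
destruct (rad_spec M (x ^ 2 - F x ^ 2) HM Hs) as [Hr Hlev]; fold (r x) in Hr, Hlev.
set (r' := rad' M (r x) * (2 * (x - F x * tanh (u x)))).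
set (u' := Acoef M (r x) * (F x - x * tanh (u x)) - Bcoef M H (r x) * / cosh (u x)).
change (accel M H x (F x) (u x)) with u' in Hu.
assert (Hdr : is_derive r x r').
{ apply (is_derive_comp_R (rad M) (fun x => x ^ 2 - F x ^ 2)); [now apply is_derive_rad|].
  auto_derive; [eexists; exact HF|].
  replace (Derive (fun x => F x) x) with (tanh (u x)) by (symmetry; now apply is_derive_unique).
  ring. }
assert (HA : is_derive (fun x => Acoef M (r x)) x (Acoef' M (r x) * r'))
  by (apply is_derive_comp_R; [now apply is_derive_Acoef | exact Hdr]).
assert (HB : is_derive (fun x => Bcoef M H (r x)) x (Bcoef' M H (r x) * r'))
  by (apply is_derive_comp_R; [now apply is_derive_Bcoef | exact Hdr]).
assert (HJ : is_derive (fun x => jcoef M (r x)) x (jcoef' M (r x) * r'))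
  by (apply is_derive_comp_R; [now apply is_derive_jcoef | exact Hdr]).
assert (Hc : is_derive (fun x => cosh (u x)) x (sinh (u x) * u'))
  by (apply is_derive_comp_R; [apply is_derive_cosh | exact Hu]).
assert (Hsh : is_derive (fun x => sinh (u x)) x (cosh (u x) * u'))
  by (apply is_derive_comp_R; [apply is_derive_sinh | exact Hu]).
assert (Hq : is_derive (fun x => root_exp M (r x)) x
               (- root_exp M (r x) * (/ (4 * M) + / (2 * r x)) * r'))
  by (apply is_derive_comp_R; [now apply is_derive_root_exp | exact Hdr]).
assert (Hdrift := jacobi_drift M H x (F x) (u x) (r x) HM Hr).
assert (Hpot := jacobi_potential M H x (F x) (u x) (r x) HM Hr Hlev).
cbv zeta in Hdrift, Hpot; fold r' u' (k x) in Hdrift, Hpot.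
match type of Hpot with context [ _ + r x * ?dk + r x * lin_accel _ _ _ _ _ _ _ _ ] =>
  set (k' := dk) in Hpot end.
destruct Hdrift as [Hdrift1 Hdrift2].
assert (Hk : is_derive k x k').
{ eapply is_derive_val; [|exact (is_derive_kappa_form _ _ _ _ _ _ _ _ _ _ _ _ _ HA HB HJ Hc Hsh HF)].
  unfold k'; ring. }
assert (Hm : is_derive m x (m x * (tanh (u x) * u' - (/ (4 * M) + / (2 * r x)) * r'))).
{ assert (Hc1 := cosh_ge_1 (u x)).
  apply (is_derive_val _ _ (- root_exp M (r x) * (/ (4 * M) + / (2 * r x)) * r' * cosh (u x)
           + root_exp M (r x) * (sinh (u x) * u'))).
  - unfold m, tanh; field; lra.
  - apply (is_derive_mult (fun x => root_exp M (r x)) (fun x => cosh (u x)));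
      [exact Hq | exact Hc | intros; apply Rmult_comm]. }
rewrite <- Hdrift2 in Hm.
split; [eexists; exact Hdr|]; split; [eexists; exact Hk|]; split; [eexists; exact Hm|].
assert (Hc1 := cosh_ge_1 (u x)).
split.
- eapply is_derive_val; [|apply (is_derive_mult m D); [exact Hm | exact HD | intros; apply Rmult_comm]].
  unfold eD, P, plus, mult; simpl; unfold m, mult; simpl; field; lra.
- eapply is_derive_val; [|apply (is_derive_mult (fun x => r x ^ 2) (fun x => W x + k x * D x) x
      (INR 2 * r' * r x ^ 1) (W' + (k' * D x + k x * D')));
    [apply (is_derive_pow r 2); exact Hdr | | intros; apply Rmult_comm]].
  + transitivity (r x * ((W x + k x * D x) * (2 * r')) + r x ^ 2 * (W' + (k' * D x + k x * D'))).
    { unfold plus, mult; simpl; unfold mult; simpl; ring. }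
    assert (Hlin : lin_accel M H x (F x) (u x) (r x) (D x) (W x)
      = D x * lin_accel M H x (F x) (u x) (r x) 1 0
        - W x * (Acoef M (r x) * x * (/ cosh (u x)) ^ 2
                 - Bcoef M H (r x) * (tanh (u x) * / cosh (u x)))).
    { unfold lin_accel; ring. }
    unfold eW, eD; rewrite Hlin.
    apply Rminus_diag_uniq.
    match type of Hdrift1 with ?L = 0 => transitivity (r x * W x * L
      + r x * D x * (2 * r' * k x + r x * k' + r x * lin_accel M H x (F x) (u x) (r x) 1 0
         - r x * stability M H x (F x) (u x) (r x))) end; [ring|].
    rewrite Hdrift1, Hpot; ring.
  + apply (is_derive_plus W (fun x => k x * D x)); [exact HW|].
    apply (is_derive_mult k D); [exact Hk | exact HD | intros; apply Rmult_comm].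
Qed.

(** The expansion of [accel] is assembled from those of its ingredients; the
    resulting linear part is then recognized as [lin_accel]. *)
Lemma accel_variation {J : Type} (M H s0 S C : R) (d X F0 F1 u0 u1 : J -> R) :
  0 < M -> - 2 * M < s0 -> 0 <= C -> (forall i, 0 <= d i <= 1) ->
  (forall i, Rabs (X i) <= C /\ Rabs (F0 i) <= C /\ Rabs (u0 i) <= C) ->
  (forall i, Rabs (F1 i - F0 i) <= C * d i /\ Rabs (u1 i - u0 i) <= C * d i) ->
  (forall i, s0 <= X i ^ 2 - F0 i ^ 2 <= S /\ s0 <= X i ^ 2 - F1 i ^ 2 <= S) ->
  exists C', 0 <= C' /\ forall i,
    Rabs (accel M H (X i) (F1 i) (u1 i) - accel M H (X i) (F0 i) (u0 i)
      - lin_accel M H (X i) (F0 i) (u0 i) (rad M (X i ^ 2 - F0 i ^ 2))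
          (F1 i - F0 i) (u1 i - u0 i)) <= C' * d i ^ 2.
Proof.
intros HM Hs0 HC Hd Hb Hinc Hs.
assert (Hd0 : forall i, 0 <= d i) by (intro i; apply Hd).
assert (Vc := fun c => variation_const d c Hd0).
assert (VX : variation d X X (fun i => X i - X i)).
{ apply (variation_increment d X X C HC); [apply Hb|]; intro i.
  rewrite Rminus_diag, Rabs_R0; apply Rmult_le_pos; [exact HC | apply Hd0]. }
assert (VF := variation_increment d F0 F1 C HC (fun i => proj1 (proj2 (Hb i)))
               (fun i => proj1 (Hinc i))).
assert (Vu := variation_increment d u0 u1 C HC (fun i => proj2 (proj2 (Hb i)))
               (fun i => proj2 (Hinc i))).
assert (Vs := variation_plus _ _ _ _ _ _ _ (variation_mult _ _ _ _ _ _ _ Hd VX VX)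
  (variation_mult _ _ _ _ _ _ _ Hd (Vc (-1)) (variation_mult _ _ _ _ _ _ _ Hd VF VF))).
assert (E : forall x f, x * x + -1 * (f * f) = x ^ 2 - f ^ 2) by (intros; ring).
assert (Vr := variation_comp d (rad M) _ _ _ _ _ Hd (C2on_rad M s0 S HM Hs0)
  (fun i => ltac:(cbv beta; rewrite E; exact (proj1 (Hs i))))
  (fun i => ltac:(cbv beta; rewrite E; exact (proj2 (Hs i)))) Vs).
assert (Hr0 : 0 < rad M s0) by (apply rad_spec; lra).
assert (Hr : forall s, s0 <= s <= S -> rad M s0 <= rad M s <= rad M S).
{ intros s Hss; split; apply rad_le; lra. }
assert (D0 : forall i, rad M s0 <= rad M (X i * X i + -1 * (F0 i * F0 i)) <= rad M S)
  by (intro i; rewrite E; apply Hr, Hs).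
assert (D1 : forall i, rad M s0 <= rad M (X i * X i + -1 * (F1 i * F1 i)) <= rad M S)
  by (intro i; rewrite E; apply Hr, Hs).
assert (Ve := variation_comp d _ _ _ _ _ _ Hd (C2on_exp (2 * M) (rad M s0) (rad M S)) D0 D1 Vr).
assert (Vi := variation_comp d _ _ _ _ _ _ Hd (C2on_inv (rad M s0) (rad M S) Hr0) D0 D1 Vr).
assert (Vq := variation_comp d _ _ _ _ _ _ Hd (C2on_root_exp M (rad M s0) (rad M S) HM Hr0) D0 D1 Vr).
assert (Vt := variation_comp d _ _ _ _ _ _ Hd C2on_tanh (fun _ => Logic.I) (fun _ => Logic.I) Vu).
assert (Vh := variation_comp d _ _ _ _ _ _ Hd C2on_sech (fun _ => Logic.I) (fun _ => Logic.I) Vu).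
assert (VA := variation_mult _ _ _ _ _ _ _ Hd Ve
  (variation_plus _ _ _ _ _ _ _
    (variation_mult _ _ _ _ _ _ _ Hd (Vc (6 * M)) (variation_mult _ _ _ _ _ _ _ Hd Vi Vi))
    (variation_mult _ _ _ _ _ _ _ Hd (Vc (-1)) Vi))).
assert (Vacc := variation_plus _ _ _ _ _ _ _
  (variation_mult _ _ _ _ _ _ _ Hd VA
    (variation_plus _ _ _ _ _ _ _ VF
      (variation_mult _ _ _ _ _ _ _ Hd (Vc (-1)) (variation_mult _ _ _ _ _ _ _ Hd VX Vt))))
  (variation_mult _ _ _ _ _ _ _ Hd (Vc (-1))
    (variation_mult _ _ _ _ _ _ _ Hd
      (variation_mult _ _ _ _ _ _ _ Hd (Vc (12 * H * M)) Vq) Vh))).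
destruct Vacc as [C' [HC' HV]]; exists C'; split; [exact HC'|]; intros i.
destruct (HV i) as [_ [_ Hi]]; cbv beta in Hi.
match type of Hi with Rabs ?L <= _ =>
  match goal with |- Rabs ?L' <= _ => replace L' with L; [exact Hi|] end end.
clear - HM Hr0 D0 D1 E.
specialize (D0 i); specialize (D1 i).
rewrite !E in *; unfold accel, lin_accel, Acoef, Acoef', Bcoef', Bcoef.
assert (Hc0 := cosh_ge_1 (u0 i)); assert (Hc1 := cosh_ge_1 (u1 i)).
set (r0 := rad M (X i ^ 2 - F0 i ^ 2)) in *; set (r1 := rad M (X i ^ 2 - F1 i ^ 2)) in *.
unfold rad'; set (e0 := exp (- (r0 / (2 * M)))); set (e1 := exp (- (r1 / (2 * M)))).
field; lra.
Qed.

(** The increments [D], [W] between the solutions of parameters [a] and [b] solve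
    the linearized equation up to [O(|b - a|^2)], with [D = 0] and,
    after a choice of sign, [W = |b - a|] at the left end. The potential being
    nonnegative, [D] stays positive up to the right end once [|b - a|] is small. *)
Lemma endpoint_increasing (M H X0 K s0 s1 L a : R) (F u : R -> R -> R) :
  0 < M -> 0 < X0 -> 0 <= K -> 0 <= L -> - 2 * M < s0 < s1 ->
  (forall b, F b (- X0) = F a (- X0) /\ u b (- X0) = b /\
     solves (- X0) X0 slope (accel_cut M H X0 K s0) (F b) (u b)) ->
  (forall b x, - X0 <= x <= X0 -> Rabs (F b x) <= K) ->
  (forall b x, - X0 <= x <= X0 ->
     Rabs (F b x - F a x) <= L * Rabs (b - a) /\ Rabs (u b x - u a x) <= L * Rabs (b - a)) ->
  (forall x, - X0 <= x <= X0 -> s1 < x ^ 2 - F a x ^ 2) ->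
  exists delta, 0 < delta /\ forall b, 0 < Rabs (b - a) < delta ->
    0 < (F b X0 - F a X0) * (b - a).
Proof.
intros HM HX0 HK HL Hs01 Hfam HFK HLip Ha.
(* For parameters within [eta] of [a] the solutions stay above the truncation
   level [s0], hence solve the equation itself. *)
set (eta := Rmin 1 ((s1 - s0) / (2 * K * L + 1))).
assert (HKL : 0 <= K * L) by nra.
assert (Heta : 0 < eta).
{ apply Rmin_glb_lt; [lra | apply Rdiv_lt_0_compat; lra]. }
assert (Heta1 : eta <= 1) by apply Rmin_l.
assert (Heta2 : (2 * K * L + 1) * eta <= s1 - s0).
{ apply Rle_trans with ((2 * K * L + 1) * ((s1 - s0) / (2 * K * L + 1))).
  - apply Rmult_le_compat_l; [lra | apply Rmin_r].
  - right; field; lra. }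
assert (Hnear : forall b x, Rabs (b - a) <= eta -> - X0 <= x <= X0 ->
          s0 <= x ^ 2 - F b x ^ 2 <= X0 ^ 2).
{ intros b x Hb Hx; split; [|assert (Hsq := pow2_ge_0 (F b x)); nra].
  specialize (Ha x Hx); destruct (HLip b x Hx) as [H1 _].
  assert (A1 := HFK b x Hx); assert (A2 := HFK a x Hx).
  assert (Hdiff : F b x ^ 2 - F a x ^ 2 <= 2 * K * L * eta).
  { replace (F b x ^ 2 - F a x ^ 2) with ((F b x + F a x) * (F b x - F a x)) by ring.
    apply Rle_trans with (1 := Rle_abs _); rewrite Rabs_mult.
    replace (2 * K * L * eta) with ((2 * K) * (L * eta)) by ring.
    apply Rmult_le_compat; try apply Rabs_pos.
    - apply Rle_trans with (1 := Rabs_triang _ _); lra.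
    - apply Rle_trans with (1 := H1); now apply Rmult_le_compat_l. }
  lra. }
assert (Hsol : forall b, Rabs (b - a) <= eta -> solves (- X0) X0 slope (accel M H) (F b) (u b)).
{ intros b Hb; destruct (Hfam b) as [_ [_ Hb']].
  apply (solves_accel_of_cut M H X0 K s0); [|exact Hb'].
  intros x Hx; split; [|apply Hnear; assumption].
  assert (HFb := HFK b x Hx); apply Rabs_le_between in HFb; exact HFb. }
assert (Haa : Rabs (a - a) <= eta) by (rewrite Rminus_diag, Rabs_R0; lra).
set (r := fun x => rad M (x ^ 2 - F a x ^ 2)).
set (k := fun x => kappa M H x (F a x) (u a x) (r x)).
set (m := fun x => root_exp M (r x) * cosh (u a x)).
assert (Hr : forall x, - X0 <= x <= X0 -> 0 < r x).
{ intros x Hx; specialize (Ha x Hx); apply rad_spec; lra. }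
assert (Hmpos : forall x, - X0 <= x <= X0 -> 0 < m x).
{ intros x Hx; specialize (Hr x Hx); apply Rmult_lt_0_compat.
  - apply Rdiv_lt_0_compat; [apply exp_pos | now apply sqrt_lt_R0].
  - assert (Hc := cosh_ge_1 (u a x)); lra. }
assert (Hreg : forall x, - X0 <= x <= X0 -> ex_derive r x /\ ex_derive k x /\ ex_derive m x).
{ intros x Hx; destruct (Hsol a Haa x Hx) as [H1 H2]; specialize (Ha x Hx).
  destruct (jacobi_system M H x _ _ (F a) (u a) (F a) (u a) HM ltac:(lra) H1 H2 H1 H2)
    as [E1 [E2 [E3 _]]]; auto. }
destruct (bounded_on_interval_pos (u a) (- X0) X0) as [Cu [HCu Hu]].
{ intros x Hx; eexists; apply (Hsol a Haa x Hx). }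
destruct (bounded_on_interval_pos m (- X0) X0) as [Cm [HCm Hm]]; [intros; now apply Hreg|].
destruct (bounded_on_interval_pos (fun x => r x ^ 2) (- X0) X0) as [Cr [HCr Hr2]].
{ intros x Hx; apply (ex_derive_pow r 2); now apply Hreg. }
destruct (bounded_on_interval_pos (fun x => r x ^ 2 * k x) (- X0) X0) as [Ck [HCk Hk]].
{ intros x Hx; apply (ex_derive_mult (fun x => r x ^ 2) k); [|now apply Hreg].
  apply (ex_derive_pow r 2); now apply Hreg. }
destruct (bounded_on_interval_pos (fun x => r x ^ 2 * cosh (u a x) ^ 2 * / m x) (- X0) X0)
  as [Cg [HCg Hg]].
{ intros x Hx; destruct (Hreg x Hx) as [[lr E1] [_ [lm E3]]]; specialize (Hmpos x Hx).
  assert (Hcosh : is_derive (fun x => cosh (u a x)) x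
                    (sinh (u a x) * accel M H x (F a x) (u a x))).
  { apply is_derive_comp_R; [apply is_derive_cosh | apply (Hsol a Haa x Hx)]. }
  apply (ex_derive_mult (fun x => r x ^ 2 * cosh (u a x) ^ 2) (fun x => / m x)).
  - apply (ex_derive_mult (fun x => r x ^ 2) (fun x => cosh (u a x) ^ 2)).
    + apply (ex_derive_pow r 2); eexists; exact E1.
    + apply (ex_derive_pow (fun x => cosh (u a x)) 2); eexists; exact Hcosh.
  - apply (ex_derive_inv m); [eexists; exact E3 | lra]. }
destruct C2on_tanh as [Ct HCt].
set (J := {p : R * R | Rabs (fst p - a) <= eta /\ - X0 <= snd p <= X0}).
destruct (@accel_variation J M H s0 (X0 ^ 2) (X0 + K + Cu + L)
  (fun p => Rabs (fst (proj1_sig p) - a)) (fun p => snd (proj1_sig p))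
  (fun p => F a (snd (proj1_sig p)))
  (fun p => F (fst (proj1_sig p)) (snd (proj1_sig p)))
  (fun p => u a (snd (proj1_sig p)))
  (fun p => u (fst (proj1_sig p)) (snd (proj1_sig p)))) as [Ca [HCa Hacc]]; try lra.
{ intros [[b x] [Hb Hx]]; simpl in *; assert (Hp := Rabs_pos (b - a)); lra. }
{ intros [[b x] [Hb Hx]]; simpl in *; specialize (HFK a x Hx); specialize (Hu x Hx).
  assert (Rabs x <= X0) by (apply Rabs_le; lra); lra. }
{ intros [[b x] [Hb Hx]]; simpl in *; destruct (HLip b x Hx) as [H1 H2].
  assert (Hp := Rabs_pos (b - a)).
  assert (L * Rabs (b - a) <= (X0 + K + Cu + L) * Rabs (b - a))
    by (apply Rmult_le_compat_r; lra); lra. }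
{ intros [[b x] [Hb Hx]]; cbv [fst snd proj1_sig] in *; split; apply Hnear; assumption. }
set (Et := Rabs Ct * L ^ 2).
assert (HEt : 0 <= Et) by (apply Rmult_le_pos; [apply Rabs_pos | apply pow2_ge_0]).
(* [E * d ^ 2] bounds the errors in the linear system, whose initial value is
   [P (- X0) = p * d]; [delta] makes the former small against the latter. *)
set (E := Cm * Et + (Cr * Ca + Ck * Et) + 1).
assert (P1 : 0 <= Cm * Et) by nra; assert (P2 : 0 <= Cr * Ca) by nra.
assert (P3 : 0 <= Ck * Et) by nra.
assert (HE : 0 < E) by (unfold E; lra).
assert (Hr0 := Hr (- X0) ltac:(lra)); set (p := r (- X0) ^ 2) in *.
assert (Hp : 0 < p) by (apply pow_lt, Hr0).
set (delta := Rmin eta (Rmin (p / (8 * X0 * E)) (/ Cg * p / (2 * E)))).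
assert (HiCg : 0 < / Cg) by now apply Rinv_0_lt_compat.
assert (HX0E : 0 < X0 * E) by nra.
exists delta; split.
{ unfold delta; repeat apply Rmin_glb_lt; try lra; apply Rdiv_lt_0_compat; nra. }
intros b [Hb0 Hb].
assert (B1 := Rmin_l eta (Rmin (p / (8 * X0 * E)) (/ Cg * p / (2 * E)))).
assert (B2 := Rmin_r eta (Rmin (p / (8 * X0 * E)) (/ Cg * p / (2 * E)))).
assert (B3 := Rmin_l (p / (8 * X0 * E)) (/ Cg * p / (2 * E))).
assert (B4 := Rmin_r (p / (8 * X0 * E)) (/ Cg * p / (2 * E))).
fold delta in B1, B2.
set (d := Rabs (b - a)) in *.
assert (Hd1 : E * d * (2 * X0) <= p / 4).
{ apply Rle_trans with (E * (p / (8 * X0 * E)) * (2 * X0)); [|right; field; lra].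
  apply Rmult_le_compat_r; [lra|]; apply Rmult_le_compat_l; lra. }
assert (Hd2 : E * d < / Cg * p / 2).
{ apply Rlt_le_trans with (E * (/ Cg * p / (2 * E))); [|right; field; lra].
  apply Rmult_lt_compat_l; lra. }
(* The sign [sg] reduces the case [b < a] to [b > a]. *)
set (sg := (b - a) / d).
assert (Hsgd : sg * d = b - a) by (unfold sg; field; lra).
assert (Hsg : Rabs sg = 1).
{ unfold sg, Rdiv; rewrite Rabs_mult, Rabs_inv; fold d.
  rewrite (Rabs_right d) by lra; field; lra. }
assert (Hsg2 : sg * sg = 1).
{ replace (sg * sg) with (sg ^ 2) by ring; rewrite <- pow2_abs, Hsg; ring. }
set (D := fun x => sg * (F b x - F a x)); set (W := fun x => sg * (u b x - u a x)).
set (D' := fun x => sg * (tanh (u b x) - tanh (u a x))).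
set (W' := fun x => sg * (accel M H x (F b x) (u b x) - accel M H x (F a x) (u a x))).
set (P := fun x => r x ^ 2 * (W x + k x * D x)).
set (eD := fun x => D' x - (/ cosh (u a x)) ^ 2 * W x).
set (eW := fun x => W' x - lin_accel M H x (F a x) (u a x) (r x) (D x) (W x)).
assert (Hb' : Rabs (b - a) <= eta) by (fold d; lra).
assert (HeD : forall x, - X0 <= x <= X0 -> Rabs (eD x) <= Et * d ^ 2).
{ intros x Hx; destruct (HCt (u a x) (u b x) Logic.I Logic.I) as [_ [_ [_ Hq]]].
  replace (eD x) with (sg * (tanh (u b x) - tanh (u a x)
     - (/ cosh (u a x)) ^ 2 * (u b x - u a x))) by (unfold eD, D', W; ring).
  rewrite Rabs_mult, Hsg, Rmult_1_l; apply Rle_trans with (1 := Hq).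
  destruct (HLip b x Hx) as [_ H2]; fold d in H2.
  unfold Et; rewrite Rmult_assoc; apply Rle_trans with (Rabs Ct * (u b x - u a x) ^ 2).
  - apply Rmult_le_compat_r; [apply pow2_ge_0 | apply Rle_abs].
  - apply Rmult_le_compat_l; [apply Rabs_pos|].
    rewrite <- Rpow_mult_distr, <- (pow2_abs (u b x - u a x)).
    apply pow_incr; split; [apply Rabs_pos | exact H2]. }
assert (HeW : forall x, - X0 <= x <= X0 -> Rabs (eW x) <= Ca * d ^ 2).
{ intros x Hx; specialize (Hacc (exist _ (b, x) (conj Hb' Hx))); simpl fst in Hacc.
  simpl snd in Hacc; fold d in Hacc.
  replace (eW x) with (sg * (accel M H x (F b x) (u b x) - accel M H x (F a x) (u a x)
    - lin_accel M H x (F a x) (u a x) (r x) (F b x - F a x) (u b x - u a x)))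
    by (unfold eW, W', lin_accel, D, W; ring).
  rewrite Rabs_mult, Hsg, Rmult_1_l; exact Hacc. }
assert (Hpos : 0 < m X0 * D X0).
{ apply (cooperative_positive (- X0) X0 (/ Cg) (E * d ^ 2) (p * d) (fun x => m x * D x)
    (fun x => root_exp M (r x) / (r x ^ 2 * cosh (u a x)) * P x + m x * eD x) P
    (fun x => r x ^ 2 * stability M H x (F a x) (u a x) (r x) * D x
                 + (r x ^ 2 * eW x + r x ^ 2 * k x * eD x))
    (fun x => root_exp M (r x) / (r x ^ 2 * cosh (u a x)))
    (fun x => r x ^ 2 * stability M H x (F a x) (u a x) (r x) / m x)); try lra.
  - nra.
  - replace (E * d ^ 2 * (X0 - - X0)) with (E * d * (2 * X0) * d) by ring; nra.
  - replace (E * d ^ 2) with (E * d * d) by ring; nra.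
  - intros x Hx; destruct (Hsol a Haa x Hx) as [H1 H2]; destruct (Hsol b Hb' x Hx) as [H3 H4].
    assert (HDd : is_derive D x (D' x)).
    { apply (is_derive_scal (fun x => F b x - F a x)).
      apply (is_derive_minus (F b) (F a)); assumption. }
    assert (HWd : is_derive W x (W' x)).
    { apply (is_derive_scal (fun x => u b x - u a x)).
      apply (is_derive_minus (u b) (u a)); assumption. }
    specialize (Ha x Hx).
    destruct (jacobi_system M H x _ _ (F a) (u a) D W HM ltac:(lra) H1 H2 HDd HWd)
      as [_ [_ [_ [J1 J2]]]].
    split; [exact J1 | exact J2].
  - intros x Hx; specialize (HeD x Hx); specialize (HeW x Hx).
    specialize (Hm x Hx); specialize (Hr2 x Hx); specialize (Hk x Hx); specialize (Hg x Hx).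
    specialize (Hmpos x Hx); specialize (Hr x Hx).
    assert (Hc := cosh_ge_1 (u a x)).
    cbv beta in *.
    assert (Hr2pos : 0 < r x ^ 2) by now apply pow_lt.
    assert (Hgpos : 0 < r x ^ 2 * cosh (u a x) ^ 2 * / m x).
    { apply Rmult_lt_0_compat; [|now apply Rinv_0_lt_compat].
      apply Rmult_lt_0_compat; [exact Hr2pos | apply pow_lt; lra]. }
    assert (Hprod : forall y z A B, Rabs y <= A -> Rabs z <= B -> Rabs (y * z) <= A * B).
    { intros y z A B Hy Hz; rewrite Rabs_mult; apply Rmult_le_compat; auto using Rabs_pos. }
    assert (Q1 := Hprod _ _ _ _ Hm HeD); assert (Q2 := Hprod _ _ _ _ Hr2 HeW).
    assert (Q3 := Hprod _ _ _ _ Hk HeD).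
    assert (Hdd : 0 <= d ^ 2) by apply pow2_ge_0.
    assert (R1 : 0 <= Cm * Et * d ^ 2) by now apply Rmult_le_pos.
    assert (R2 : 0 <= Cr * Ca * d ^ 2) by now apply Rmult_le_pos.
    assert (R3 : 0 <= Ck * Et * d ^ 2) by now apply Rmult_le_pos.
    replace (E * d ^ 2) with (Cm * Et * d ^ 2 + (Cr * Ca * d ^ 2 + Ck * Et * d ^ 2) + d ^ 2)
      by (unfold E; ring).
    apply Rabs_le_between in Q1, Q2, Q3.
    split; [|split; [|split]].
    + replace (root_exp M (r x) / (r x ^ 2 * cosh (u a x)))
        with (/ (r x ^ 2 * cosh (u a x) ^ 2 * / m x)).
      * apply Rinv_le_contravar; [exact Hgpos|].
        rewrite Rabs_right in Hg by lra; exact Hg.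
      * assert (Hq : root_exp M (r x) <> 0).
        { intro Hq; unfold m in Hmpos; rewrite Hq in Hmpos; lra. }
        unfold m; field; repeat split; try lra; exact Hq.
    + apply Rmult_le_pos; [|left; now apply Rinv_0_lt_compat].
      apply Rmult_le_pos; [lra|]; unfold stability.
      assert (S1 := pow2_ge_0 (Bcoef M H (r x)
                     - jcoef M (r x) * (F a x * cosh (u a x) - x * sinh (u a x)))).
      assert (S2 := pow2_ge_0 (jcoef M (r x) * (F a x * cosh (u a x) - x * sinh (u a x)))).
      lra.
    + lra.
    + replace (r x ^ 2 * stability M H x (F a x) (u a x) (r x) / m x * (m x * D x))
        with (r x ^ 2 * stability M H x (F a x) (u a x) (r x) * D x) by (field; lra).
      lra.
  - unfold D; destruct (Hfam b) as [-> _]; right; ring.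
  - unfold P, D, W; destruct (Hfam b) as [-> [-> _]]; destruct (Hfam a) as [_ [-> _]].
    fold p; rewrite Rminus_diag, Rmult_0_r, Rmult_0_r, Rplus_0_r.
    rewrite <- Hsgd; replace (sg * (sg * d)) with (sg * sg * d) by ring.
    rewrite Hsg2; ring. }
specialize (Hmpos X0 ltac:(lra)).
assert (HDpos : 0 < D X0) by (apply (Rmult_lt_reg_l (m X0)); lra).
rewrite <- Hsgd; unfold D in HDpos.
replace ((F b X0 - F a X0) * (sg * d)) with (sg * (F b X0 - F a X0) * d) by ring.
now apply Rmult_lt_0_compat.
Qed.

(** * From the hypersurface to the rapidity and back *)

Lemma Rpower_sq_three_halves (c : R) : 0 < c -> Rpower (c ^ 2) (3 / 2) = c ^ 3.
Proof.
intros Hc; rewrite <- (Rpower_pow 2), Rpower_mult, <- (Rpower_pow 3) by exact Hc.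
f_equal; simpl; field.
Qed.

Lemma SS_CMC_rapidity (M H X F u v : R) :
  SS_CMC_equation M H X F (tanh u) ((/ cosh u) ^ 2 * v) <-> v = accel M H X F u.
Proof.
assert (Hc := sech_bounds u).
assert (E : forall r, (/ cosh u) ^ 2 * v
  + exp (- (r / (2 * M))) * (6 * M / r ^ 2 - 1 / r) * (- F + tanh u * X) * (1 - tanh u ^ 2)
  + 12 * H * M * exp (- (r / (4 * M))) / sqrt r * Rpower (1 - tanh u ^ 2) (3 / 2)
  = (/ cosh u) ^ 2 * (v - (Acoef M r * (F - X * tanh u) - Bcoef M H r * / cosh u))).
{ intros r; rewrite tanh_sq, Rpower_sq_three_halves by lra.
  unfold Acoef, Bcoef, root_exp, Rdiv; ring. }
unfold SS_CMC_equation; rewrite E, radius_rad; unfold accel.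
assert (Hc2 : (/ cosh u) ^ 2 <> 0) by (apply pow_nonzero; lra).
split; intros Hv.
- apply Rmult_integral in Hv; destruct Hv as [Hv | Hv]; [contradiction | lra].
- rewrite Hv; ring.
Qed.

Definition artanh (p : R) : R := / 2 * ln ((1 + p) / (1 - p)).

Lemma tanh_artanh (p : R) : -1 < p < 1 -> tanh (artanh p) = p.
Proof.
intros Hp; unfold artanh, tanh, sinh, cosh; rewrite exp_Ropp.
set (q := (1 + p) / (1 - p)).
assert (Hq : 0 < q) by (apply Rdiv_lt_0_compat; lra).
set (e := exp (/ 2 * ln q)); assert (He : 0 < e) by apply exp_pos.
assert (Hee : e * e = q).
{ unfold e; rewrite <- exp_plus.
  replace (/ 2 * ln q + / 2 * ln q) with (ln q) by field; now apply exp_ln. }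
replace ((e - / e) / 2 / ((e + / e) / 2)) with ((e * e - 1) / (e * e + 1))
  by (field; repeat split; nra).
rewrite Hee; unfold q; field; lra.
Qed.

Lemma is_derive_artanh (p : R) : -1 < p < 1 -> is_derive artanh p (/ (1 - p ^ 2)).
Proof.
intros Hp; assert (Hq : 0 < (1 + p) / (1 - p)) by (apply Rdiv_lt_0_compat; lra).
assert (0 < 1 - p ^ 2) by nra.
unfold artanh; auto_derive; [repeat split; first [exact Hq | lra] | field; repeat split; nra].
Qed.

(** Extension by the tangents at the endpoints: derivatives relative to the
    interval become two-sided derivatives. *)
Definition extend (a b : R) (f f1 : R -> R) (x : R) : R :=
  f (clamp a b x) + f1 (clamp a b x) * (x - clamp a b x).

Lemma extend_inside (a b : R) (f f1 : R -> R) (x : R) : a <= x <= b -> extend a b f f1 x = f x.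
Proof. intros Hx; unfold extend; rewrite (clamp_id a b x Hx); ring. Qed.

Lemma is_derive_extend (a b : R) (f f1 : R -> R) (x : R) : a < b -> a <= x <= b ->
  D_in f f1 (fun y => a <= y <= b) x -> is_derive (extend a b f f1) x (f1 x).
Proof.
intros Hab Hx HD; apply is_derive_Reals; intros eps Heps.
destruct (HD eps Heps) as [d [Hd Hlim]].
set (d1 := if Rlt_dec x b then b - x else 1).
set (d2 := if Rlt_dec a x then x - a else 1).
assert (Hd1 : 0 < d1) by (unfold d1; destruct (Rlt_dec x b); lra).
assert (Hd2 : 0 < d2) by (unfold d2; destruct (Rlt_dec a x); lra).
assert (Hpos : 0 < Rmin d (Rmin d1 d2)) by (repeat apply Rmin_glb_lt; lra).
exists (mkposreal _ Hpos); intros h Hh0 Hh; simpl in Hh.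
assert (B1 := Rmin_l d (Rmin d1 d2)); assert (B2 := Rmin_r d (Rmin d1 d2)).
assert (B3 := Rmin_l d1 d2); assert (B4 := Rmin_r d1 d2).
rewrite (extend_inside a b f f1 x Hx).
assert (Hh' := Rabs_def2 _ _ Hh).
destruct (Rlt_dec b (x + h)) as [Hr | Hr]; [|destruct (Rlt_dec (x + h) a) as [Hl | Hl]].
- assert (x = b) by (unfold d1 in *; destruct (Rlt_dec x b); lra); subst x.
  unfold extend, clamp; rewrite (Rmin_left b (b + h)), Rmax_right by lra.
  replace ((f b + f1 b * (b + h - b) - f b) / h - f1 b) with 0 by (field; exact Hh0).
  rewrite Rabs_R0; exact Heps.
- assert (x = a) by (unfold d2 in *; destruct (Rlt_dec a x); lra); subst x.
  unfold extend, clamp; rewrite (Rmin_right b (a + h)), Rmax_left by lra.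
  replace ((f a + f1 a * (a + h - a) - f a) / h - f1 a) with 0 by (field; exact Hh0).
  rewrite Rabs_R0; exact Heps.
- rewrite extend_inside by lra.
  assert (Hc : D_x (fun y => a <= y <= b) x (x + h) /\ Rabs (x + h - x) < d).
  { split; [split; [lra | lra]|]; replace (x + h - x) with h by ring; lra. }
  specialize (Hlim (x + h) Hc); unfold dist in Hlim; simpl in Hlim; unfold Rdist in Hlim.
  replace (x + h - x) with h in Hlim by ring; exact Hlim.
Qed.

Lemma D_in_of_is_derive (f f1 : R -> R) (D : R -> Prop) (x : R) :
  is_derive f x (f1 x) -> D_in f f1 D x.
Proof.
intros Hd; apply is_derive_Reals in Hd; intros eps Heps.
destruct (Hd eps Heps) as [d Hd'].
exists d; split; [apply cond_pos|]; intros y [[_ Hy] Hyd].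
unfold dist in *; simpl in *; unfold Rdist in *.
specialize (Hd' (y - x) ltac:(lra) Hyd); replace (x + (y - x)) with y in Hd' by ring; exact Hd'.
Qed.

Lemma Dirichlet_rapidity (M H T0 X0 : R) (G : R -> R) : 0 < X0 ->
  SS_CMC_Dirichlet_solution M H T0 X0 G ->
  exists F u, (forall X, - X0 <= X <= X0 -> F X = G X /\ in_kruskal M (F X) X) /\
    solves (- X0) X0 slope (accel M H) F u.
Proof.
intros HX0 [F1 [F2 [HG _]]].
set (F := extend (- X0) X0 G F1); set (p := extend (- X0) X0 F1 F2).
exists F, (fun x => artanh (p x)).
assert (Hin : forall X, - X0 <= X <= X0 -> F X = G X /\ p X = F1 X /\ -1 < p X < 1).
{ intros X HX; destruct (HG X HX) as [_ [_ [_ [Hsp _]]]].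
  unfold F, p; rewrite !extend_inside by exact HX; repeat split; nra. }
split.
- intros X HX; destruct (Hin X HX) as [E _]; rewrite E; split; [reflexivity|].
  now destruct (HG X HX) as [_ [_ [HK _]]].
- intros X HX; destruct (Hin X HX) as [E1 [E2 Hp]].
  destruct (HG X HX) as [HD1 [HD2 [_ [_ Heq]]]].
  assert (Hth := tanh_artanh _ Hp).
  split.
  + unfold slope; rewrite Hth, E2; apply is_derive_extend; [lra | exact HX | exact HD1].
  + assert (Hder : is_derive (fun x => artanh (p x)) X (/ (1 - p X ^ 2) * F2 X)).
    { apply is_derive_comp_R; [now apply is_derive_artanh|].
      apply is_derive_extend; [lra | exact HX | exact HD2]. }
    apply (is_derive_val _ _ (/ (1 - p X ^ 2) * F2 X)); [|exact Hder].
    assert (Hpos : 0 < 1 - p X ^ 2) by nra.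
    rewrite <- SS_CMC_rapidity, <- tanh_sq, Hth, E1.
    rewrite <- E2 in Heq.
    replace ((1 - p X ^ 2) * (/ (1 - p X ^ 2) * F2 X)) with (F2 X) by (field; lra).
    exact Heq.
Qed.

Lemma rapidity_Dirichlet (M H T0 X0 : R) (F u : R -> R) :
  solves (- X0) X0 slope (accel M H) F u ->
  (forall X, - X0 <= X <= X0 -> in_kruskal M (F X) X) ->
  F X0 = T0 -> F (- X0) = T0 -> SS_CMC_Dirichlet_solution M H T0 X0 F.
Proof.
intros Hsol HK HT HT'.
exists (fun X => tanh (u X)), (fun X => (/ cosh (u X)) ^ 2 * accel M H X (F X) (u X)).
split; [|now split].
intros X HX; destruct (Hsol X HX) as [H1 H2].
split; [now apply D_in_of_is_derive|].
split.
{ apply D_in_of_is_derive; apply is_derive_comp_R; [apply is_derive_tanh | exact H2]. }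
split; [now apply HK|]; split.
- rewrite tanh_sq; apply pow_lt, sech_bounds.
- now apply SS_CMC_rapidity.
Qed.

(** * The shooting argument *)

Lemma solution_growth (X0 : R) (f : R -> R -> R -> R) (F u : R -> R) :
  solves (- X0) X0 slope f F u ->
  forall x, - X0 <= x <= X0 -> Rabs (F x) <= Rabs (F (- X0)) + 2 * X0.
Proof.
intros Hsol x Hx.
destruct (mean_value F (fun t => tanh (u t)) (- X0) x) as [c [Hc E]];
  [lra | intros; apply Hsol; lra|].
replace (F x) with (F (- X0) + tanh (u c) * (x - - X0)) by lra.
apply Rle_trans with (1 := Rabs_triang _ _); apply Rplus_le_compat_l.
assert (Ht := tanh_bounds (u c)); rewrite Rabs_mult, (Rabs_right (x - - X0)) by lra.
assert (Rabs (tanh (u c)) <= 1) by (apply Rabs_le; lra).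
assert (Hp := Rabs_pos (tanh (u c))); nra.
Qed.

Lemma shooting_family (M H T0 X0 K s0 : R) : 0 < M -> 0 < X0 -> 0 <= K ->
  - 2 * M < s0 <= X0 ^ 2 ->
  exists F u : R -> R -> R, forall b, F b (- X0) = T0 /\ u b (- X0) = b /\
     solves (- X0) X0 slope (accel_cut M H X0 K s0) (F b) (u b).
Proof.
intros HM HX0 HK Hs0.
assert (Hex : forall b, exists q : (R -> R) * (R -> R), fst q (- X0) = T0 /\ snd q (- X0) = b /\
     solves (- X0) X0 slope (accel_cut M H X0 K s0) (fst q) (snd q)).
{ intros b; destruct (cauchy_lipschitz (- X0) X0 slope (accel_cut M H X0 K s0) T0 b)
    as [y [z Hyz]]; [lra | exact BL_slope | now apply BL_accel_cut | now exists (y, z)]. }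
exists (fun b => fst (proj1_sig (constructive_indefinite_description _ (Hex b)))),
       (fun b => snd (proj1_sig (constructive_indefinite_description _ (Hex b)))).
intros b; exact (proj2_sig (constructive_indefinite_description _ (Hex b))).
Qed.

(** The rapidity stays within [2 C X0] of its initial value [b], where [C] bounds
    the field. For [|b|] larger than that it has the sign of [b] throughout, and so
    has [F_b(X0) - T0]. *)
Lemma shooting_hits (X0 T0 : R) (f : R -> R -> R -> R) (F u : R -> R -> R) : 0 < X0 -> BL f ->
  (forall b, F b (- X0) = T0 /\ u b (- X0) = b /\ solves (- X0) X0 slope f (F b) (u b)) ->
  continuity (fun b => F b X0) -> exists b, F b X0 = T0.
Proof.
intros HX0 [C [HC [Hf _]]] Hfam Hcont.
assert (Hu : forall b x, - X0 <= x <= X0 -> Rabs (u b x - b) <= C * (2 * X0)).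
{ intros b x Hx; destruct (Hfam b) as [_ [Hb Hsol]]; rewrite <- Hb at 2.
  apply Rle_trans with (C * Rabs (x - - X0)).
  - apply (mean_value_abs (u b) (fun t => f t (F b t) (u b t)));
      intros t Ht; rewrite Rmin_left, Rmax_right in Ht by lra; [apply Hsol; lra | apply Hf].
  - apply Rmult_le_compat_l; [exact HC|]; rewrite Rabs_right; lra. }
set (B := C * (2 * X0) + 1).
assert (HB : 0 < B) by (unfold B; assert (0 <= C * (2 * X0)) by (apply Rmult_le_pos; lra); lra).
assert (Hmono : forall b, exists c, - X0 <= c <= X0 /\
          F b X0 - T0 = tanh (u b c) * (2 * X0)).
{ intros b; destruct (Hfam b) as [HT [_ Hsol]].
  destruct (mean_value (F b) (fun t => tanh (u b t)) (- X0) X0) as [c [Hc E]];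
    [lra | intros; apply Hsol; lra|].
  exists c; split; [exact Hc|]; rewrite <- HT, E; ring. }
assert (Htanh : forall v, (0 < v -> 0 < tanh v) /\ (v < 0 -> tanh v < 0)).
{ intros v; assert (Hc := cosh_ge_1 v); assert (Hs := sinh_lt); unfold tanh.
  split; intros Hv; specialize (Hs _ _ Hv); rewrite sinh_0 in Hs.
  - apply Rdiv_lt_0_compat; lra.
  - apply Ropp_lt_cancel; rewrite Ropp_0, <- Rdiv_opp_l; apply Rdiv_lt_0_compat; lra. }
destruct (IVT (fun b => F b X0 - T0) (- B) B) as [b [_ Hb]].
- apply (continuity_minus (fun b => F b X0) (fun _ => T0)); [exact Hcont|].
  apply continuity_const; now intros x y.
- lra.
- destruct (Hmono (- B)) as [c [Hc ->]]; assert (H1 := Hu (- B) c Hc).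
  apply Rabs_le_between in H1.
  destruct (Htanh (u (- B) c)) as [_ Hn]; assert (tanh (u (- B) c) < 0) by (apply Hn; unfold B in *; lra).
  nra.
- destruct (Hmono B) as [c [Hc ->]]; assert (H1 := Hu B c Hc).
  apply Rabs_le_between in H1.
  destruct (Htanh (u B c)) as [Hn _]; assert (0 < tanh (u B c)) by (apply Hn; unfold B in *; lra).
  nra.
- exists b; lra.
Qed.

Theorem mainTheorem1 :
  forall M : R, 0 < M ->
  forall H T0 X0 : R, 0 < X0 ->
    in_kruskal M T0 X0 -> in_kruskal M T0 (- X0) ->
    exists F : R -> R,
      SS_CMC_Dirichlet_solution M H T0 X0 F /\
      (forall G : R -> R, SS_CMC_Dirichlet_solution M H T0 X0 G ->
         forall X : R, - X0 <= X <= X0 -> G X = F X).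
Proof.
intros M HM H T0 X0 HX0 Hin _.
set (K := Rabs T0 + 2 * X0).
assert (HK : 0 <= K) by (unfold K; assert (HT := Rabs_pos T0); lra).
destruct (barrier_levels M H X0 T0 K HM HK Hin) as [s0 [s1 [Hs01 [Hs1 Hsteep]]]].
assert (HX0sq : s0 <= X0 ^ 2) by (assert (HT := pow2_ge_0 T0); lra).
set (f := accel_cut M H X0 K s0).
assert (HBf : BL f) by (apply BL_accel_cut; auto; lra).
assert (HFK : forall g F u, F (- X0) = T0 -> solves (- X0) X0 slope g F u ->
          forall x, - X0 <= x <= X0 -> Rabs (F x) <= K).
{ intros g F u HT Hsol x Hx; unfold K; rewrite <- HT; now apply (solution_growth X0 g F u). }
assert (Hcut : forall F u, F (- X0) = T0 -> F X0 = T0 -> solves (- X0) X0 slope f F u ->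
          forall x, - X0 <= x <= X0 -> s1 < x ^ 2 - F x ^ 2).
{ intros F u HT HT' Hsol.
  apply (barrier (- X0) X0 s1 F u (fun x => f x (F x) (u x))); [lra | exact Hsol | | |].
  - intros x Hx Hs; assert (HF := HFK f F u HT Hsol x Hx).
    unfold f, accel_cut; rewrite (clamp_id (- X0) X0 x Hx).
    rewrite (clamp_id (- K) K (F x)) by (apply Rabs_le_between; exact HF).
    apply Hsteep; [|exact Hs | exact HF].
    assert (Hc := clamp_bounds s0 (X0 ^ 2) (x ^ 2 - F x ^ 2) HX0sq).
    split; [lra|]; unfold clamp; apply Rmax_lub; [lra|].
    apply Rle_trans with (1 := Rmin_r _ _); exact Hs.
  - rewrite HT; replace ((- X0) ^ 2) with (X0 ^ 2) by ring; exact Hs1.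
  - rewrite HT'; exact Hs1. }
destruct (shooting_family M H T0 X0 K s0 HM HX0 HK ltac:(lra)) as [F [u Hfam]].
destruct (continuous_dependence (- X0) X0 slope f ltac:(lra) BL_slope HBf) as [L [HL Hdep]].
assert (HLip : forall a b x, - X0 <= x <= X0 ->
   Rabs (F b x - F a x) <= L * Rabs (b - a) /\ Rabs (u b x - u a x) <= L * Rabs (b - a)).
{ intros a b x Hx; destruct (Hfam a) as [Ea [Ua Sa]]; destruct (Hfam b) as [Eb [Ub Sb]].
  assert (Hd := Hdep (F a) (u a) (F b) (u b) Sa Sb ltac:(lra) x Hx).
  rewrite Ua, Ub in Hd; exact Hd. }
assert (Hcont : continuity (fun b => F b X0)).
{ apply (Lipschitz_continuity L); intros a b; apply HLip; lra. }
destruct (shooting_hits X0 T0 f F u HX0 HBf Hfam Hcont) as [a Ha].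
assert (Huniq : forall b, F b X0 = T0 -> b = a).
{ assert (Hno := unique_crossing (fun b => F b X0) T0 Hcont).
  assert (Hup : forall a, F a X0 = T0 -> exists d, 0 < d /\ forall b, 0 < Rabs (b - a) < d ->
            0 < (F b X0 - F a X0) * (b - a)).
  { clear a Ha Hno; intros a Ha; destruct (Hfam a) as [Ea [_ Sa]].
    apply (endpoint_increasing M H X0 K s0 s1 L a F u); auto.
    - intros b; destruct (Hfam b) as [Eb [Ub Sb]]; rewrite Ea; auto.
    - intros b; destruct (Hfam b) as [Eb [Ub Sb]]; now apply (HFK f (F b) (u b)).
    - now apply (Hcut (F a) (u a)). }
  specialize (Hno Hup).
  intros b Hb; destruct (Rtotal_order a b) as [Hlt | [He | Hlt]].
  - destruct (Hno a b Hlt Ha Hb).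
  - now symmetry.
  - destruct (Hno b a Hlt Hb Ha). }
destruct (Hfam a) as [Ea [Ua Sa]].
assert (Hinside : forall F u g, F (- X0) = T0 -> solves (- X0) X0 slope g F u ->
   (forall x, - X0 <= x <= X0 -> s1 < x ^ 2 - F x ^ 2) ->
   forall x, - X0 <= x <= X0 -> - K <= F x <= K /\ s0 <= x ^ 2 - F x ^ 2).
{ intros F' u' g HT Hsol Hs x Hx; specialize (Hs x Hx); split; [|lra].
  apply Rabs_le_between, (HFK g F' u' HT Hsol x Hx). }
exists (F a); split.
- assert (Hs := Hcut (F a) (u a) Ea Ha Sa).
  apply (rapidity_Dirichlet M H T0 X0 (F a) (u a)); auto.
  + apply (solves_accel_of_cut M H X0 K s0); [|exact Sa].
    exact (Hinside (F a) (u a) f Ea Sa Hs).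
  + intros x Hx; specialize (Hs x Hx); unfold in_kruskal; lra.
- intros G HG X HX.
  destruct (Dirichlet_rapidity M H T0 X0 G HX0 HG) as [G' [v [HG' Hsol]]].
  destruct HG as [_ [_ [_ [HGr HGl]]]].
  assert (El : G' (- X0) = T0) by (rewrite (proj1 (HG' (- X0) ltac:(lra))); exact HGl).
  assert (Er : G' X0 = T0) by (rewrite (proj1 (HG' X0 ltac:(lra))); exact HGr).
  assert (Hs : forall x, - X0 <= x <= X0 -> s1 < x ^ 2 - G' x ^ 2).
  { apply (barrier (- X0) X0 s1 G' v (fun x => accel M H x (G' x) (v x)));
      [lra | exact Hsol | | |].
    - intros x Hx Hle; apply Hsteep; [|exact Hle | now apply (HFK (accel M H) G' v)].
      destruct (HG' x Hx) as [_ Hk]; unfold in_kruskal in Hk; lra.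
    - rewrite El; replace ((- X0) ^ 2) with (X0 ^ 2) by ring; exact Hs1.
    - rewrite Er; exact Hs1. }
  assert (Hsol' : solves (- X0) X0 slope f G' v).
  { apply solves_accel_of_cut; [|exact Hsol].
    exact (Hinside G' v (accel M H) El Hsol Hs). }
  assert (Hsame : forall x, - X0 <= x <= X0 -> G' x = F (v (- X0)) x).
  { intros x Hx; destruct (Hfam (v (- X0))) as [Ev [Uv Sv]].
    destruct (Hdep _ _ _ _ Sv Hsol' ltac:(lra) x Hx) as [Hd _].
    rewrite Uv, Rminus_diag, Rabs_R0, Rmult_0_r in Hd.
    apply Rminus_diag_uniq, Rabs_eq_0, Rle_antisym; [exact Hd | apply Rabs_pos]. }
  assert (Hv : v (- X0) = a) by (apply Huniq; rewrite <- Hsame by lra; exact Er).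
  rewrite <- (proj1 (HG' X HX)), (Hsame X HX), Hv; reflexivity.
Qed.
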